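(* The elements $H_1,T,T^{-1},F_1,H_2,E_2,F_2,H_3,E_3,F_3$ (defined in the context by the nonlinear map) generate the associative superalgebra ${\cal U}_{\mathsf h}(sl(2|1))$; the odd ones among them are exactly $E_2,F_2,E_3,F_3$ (all others are even), and this determines the $\mathbb Z_2$-grading. They satisfy the following relations, where $[\cdot,\cdot]$ is the $\mathbb Z_2$-graded commutator: \begin{align*} &TT^{-1}=T^{-1}T=1,\quad [H_1,T^{\pm1}]=T^{\pm2}-1,\quad [T^{\pm1},F_1]=\pm\tfrac{\mathsf h}{2}\left(H_1T^{\pm1}+T^{\pm1}H_1\right),\\ &[H_1,F_1]=-\tfrac12\left(TF_1+F_1T+T^{-1}F_1+F_1T^{-1}\right),\\ &[H_1,H_2]=-\tfrac14(T-T^{-1})^2H_1,\quad [H_1,H_3]=\tfrac14(T-T^{-1})^2H_1,\quad [H_2,H_3]=0,\\ &[H_1,E_2]=-\tfrac12(T+T^{-1})E_2-\tfrac{\mathsf h}{2}(T-T^{-1})E_3H_1-\tfrac{\mathsf h}{4}(T^2-T^{-2})E_3,\\ &[H_1,F_3]=-\tfrac12(T+T^{-1})F_3+\tfrac{\mathsf h}{2}(T-T^{-1})F_2H_1+\tfrac{\mathsf h}{4}(T^2-T^{-2})F_2,\\ &[H_1,F_2]=\tfrac12(T+T^{-1})F_2,\quad [H_1,E_3]=\tfrac12(T+T^{-1})E_3,\\ &[H_2,T^{\pm1}]=-\tfrac14(T^{\pm3}-T^{\mp1}),\quad [H_3,T^{\pm1}]=\tfrac14(T^{\pm3}-T^{\mp1}),\\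 &[H_2,F_1]=\tfrac14(T+T^{-1})^2F_1-\tfrac{\mathsf h}{4}(T-T^{-1})H_1^2-\tfrac{\mathsf h}{4}(T^2-T^{-2})H_1-\tfrac{\mathsf h}{16}(T^2-T^{-2})(T+T^{-1}),\\ &[H_3,F_1]=-\tfrac14(T+T^{-1})^2F_1+\tfrac{\mathsf h}{4}(T-T^{-1})H_1^2+\tfrac{\mathsf h}{4}(T^2-T^{-2})H_1+\tfrac{\mathsf h}{16}(T^2-T^{-2})(T+T^{-1}),\\ &[H_2,E_2]=\tfrac{\mathsf h}{16}(T+T^{-1})(T^2-T^{-2})E_3+\tfrac18(T-T^{-1})^2E_2,\\ &[H_3,F_3]=\tfrac{\mathsf h}{16}(T+T^{-1})(T^2-T^{-2})F_2-\tfrac18(T-T^{-1})^2F_3,\\ &[H_2,F_3]=\tfrac18(T^2+6+T^{-2})F_3-\tfrac{\mathsf h}{16}(T^2-T^{-2})(T+T^{-1})F_2,\\ &[H_3,E_2]=-\tfrac18(T^2+6+T^{-2})E_2-\tfrac{\mathsf h}{16}(T^2-T^{-2})(T+T^{-1})E_3,\\ &[H_2,F_2]=-\tfrac18(T-T^{-1})^2F_2,\quad [H_3,E_3]=\tfrac18(T-T^{-1})^2E_3,\\ &[H_3,F_2]=\tfrac18(T^2+6+T^{-2})F_2,\quad [H_2,E_3]=-\tfrac18(T^2+6+T^{-2})E_3,\\ &[E_2,F_2]=H_2-\tfrac1{16}(T-T^{-1})^2-\tfrac{\mathsf h}{4}(T-T^{-1})E_3F_2,\\ &[E_3,F_3]=H_3+\tfrac1{16}(T-T^{-1})^2+\tfrac{\mathsf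 h}{4}(T-T^{-1})F_2E_3,\\ &[T^{\pm1},F_2]=[T^{\pm1},E_3]=0,\quad F_2^2=E_3^2=0,\quad [F_2,F_1]=F_3,\quad [F_1,E_3]=E_2,\\ &E_2^2=\tfrac{\mathsf h}{4}(T-T^{-1})E_3E_2,\quad F_3^2=-\tfrac{\mathsf h}{4}(T-T^{-1})F_2F_3,\quad [E_2,E_3]=[F_2,F_3]=0,\\ &[T^{\pm1},E_2]=\pm\tfrac{\mathsf h}{2}(T^{\pm2}+1)E_3,\quad [T^{\pm1},F_3]=\mp\tfrac{\mathsf h}{2}(T^{\pm2}+1)F_2,\quad [F_2,E_3]=\tfrac1{2\mathsf h}(T-T^{-1}),\\ &[E_2,F_1]=\tfrac{\mathsf h}{4}(T-T^{-1})E_2+\tfrac{\mathsf h}{2}(T-T^{-1})E_3F_1-\tfrac{\mathsf h^2}{4}E_3H_1^2-\tfrac{3\mathsf h^2}{8}(T+T^{-1})E_3H_1-\tfrac{\mathsf h^2}{2}E_3-\tfrac{15\mathsf h^2}{64}(T-T^{-1})^2E_3,\\ &[F_3,F_1]=\tfrac{\mathsf h}{4}(T-T^{-1})F_3-\tfrac{\mathsf h}{2}(T-T^{-1})F_2F_1+\tfrac{\mathsf h^2}{4}F_2H_1^2+\tfrac{3\mathsf h^2}{8}(T+T^{-1})F_2H_1+\tfrac{\mathsf h^2}{2}F_2+\tfrac{15\mathsf h^2}{64}(T-T^{-1})^2F_2,\\ &[F_3,E_2]=F_1-\tfrac{\mathsf h}{4}(T-T^{-1})F_2E_2+\tfrac{\mathsf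 h}{4}(T-T^{-1})E_3F_3-\tfrac{\mathsf h}{8}(T-T^{-1})H_1^2-\tfrac{\mathsf h}{8}(T^2-T^{-2})H_1\\ &\qquad\qquad-\tfrac{\mathsf h}{16}H_1(T^2-T^{-2})+\tfrac{7\mathsf h}{128}(T-T^{-1})^3. \end{align*} Moreover, as $\mathsf h\to0$, $(E_2,F_2,H_2,E_3,F_3,H_3)\to(e_2,f_2,h_2,e_3,f_3,h_3)$.
   Context: Let $a_{11}=2$, $a_{12}=a_{21}=-1$, $a_{22}=0$. ${\cal U}(sl(2|1))$ is the associative superalgebra over $\mathbb C$ generated by $h_i,e_i,f_i$ ($i=1,2$), with $e_2,f_2$ odd and the other generators even, subject to $[h_i,h_j]=0$, $[h_i,e_j]=a_{ij}e_j$, $[h_i,f_j]=-a_{ij}f_j$, $[e_i,f_j]=\delta_{ij}h_i$, $[e_2,e_2]=[f_2,f_2]=0$, $[e_1,[e_1,e_2]]=[f_1,[f_1,f_2]]=0$, where $[a,b]=ab-(-1)^{\deg(a)\deg(b)}ba$ is the $\mathbb Z_2$-graded commutator. Put $e_3=e_1e_2-e_2e_1$, $f_3=f_2f_1-f_1f_2$, $h_3=h_1+h_2$. Let $\mathsf h$ be the deformation parameter; all expressions are understood as formal power series in $\mathsf h$, i.e. in ${\cal U}(sl(2|1))[[\mathsf h]]$, and ''generate'' is understood in the $\mathsf h$-adic sense. Define (nonlinear map) \begin{align*} &T^{\pm1}=\pm\mathsf h e_1+\sqrt{1+\mathsf h^2e_1^2},\quad H_1=\sqrt{1+\mathsf h^2e_1^2}\,h_1,\quad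 F_1=f_1-\tfrac{\mathsf h^2}{4}e_1(h_1^2-1),\\ &H_2=h_2-\tfrac{\mathsf h^2}{2}e_1^2h_1,\quad E_2=e_2-\tfrac{\mathsf h^2}{4}e_1e_3(2h_1+1),\quad F_2=f_2,\\ &H_3=h_3+\tfrac{\mathsf h^2}{2}e_1^2h_1,\quad E_3=e_3,\quad F_3=f_3+\tfrac{\mathsf h^2}{4}e_1f_2(2h_1+1). \end{align*} ${\cal U}_{\mathsf h}(sl(2|1))$ denotes the superalgebra ${\cal U}(sl(2|1))[[\mathsf h]]$ described through these deformed generators. An expression such as $\frac1{2\mathsf h}(T-T^{-1})$ denotes the unique element whose product with $2\mathsf h$ is $T-T^{-1}$. *)

(* Defs.v *)
From HB Require Import structures.
From mathcomp Require Import all_boot all_order all_algebra.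
From mathcomp Require Import boolp classical_sets reals.
From mathcomp Require Import complex monalg.

Set Implicit Arguments.
Unset Strict Implicit.
Unset Printing Implicit Defensive.

Import GRing.Theory.
Local Open Scope ring_scope.
Local Open Scope classical_set_scope.
Local Open Scope quotient_scope.

(* [sbracket O x y] is the Z/2-graded commutator of two homogeneous elements
   x and y, where O is the set of odd elements: the sign (-1)^(deg x deg y) is
   -1 exactly when both arguments are odd. (0 is both even and odd; its bracket
   with anything is 0 under either reading.) *)
Definition sbracket (A : nzRingType) (O : set A) (x y : A) : A :=
  x * y - (-1) ^+ (`[< O x >] && `[< O y >]) * (y * x).

Section Presentation.
Context (K : fieldType) (I : choiceType) (par : I -> bool).

(* The free associative algebra K<I>: the algebra of the monoid of words. *)
Local Notation free_alg := {malg K[{fmonom I}]}.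

Definition free_gen (i : I) : free_alg := << fmu i >>.

Definition word_parity (w : {fmonom I}) : bool := odd (count par (w : seq I)).

Definition free_part (b : bool) : set free_alg :=
  [set x | forall w, x@_w != 0 -> word_parity w = b].

Definition two_sided_ideal (J : set free_alg) : Prop :=
  [/\ J 0, (forall x y, J x -> J y -> J (x + y))
    & (forall a x b, J x -> J (a * x * b))].

Lemma malg_scaleAr c (x y : free_alg) : c *: (x * y) = x * (c *: y).
Proof.
have mulC z : z * c%:MP = c *: z.
  rewrite malgM_def fgmulgU malgZ_def; apply: eq_bigr => k _.
  by rewrite mulm1 mulrC.
by rewrite -mulC -mulrA mulC.
Qed.

Lemma counitM (x y : free_alg) :
  (x * y)@_(mone : {fmonom I}) =
  x@_(mone : {fmonom I}) * y@_(mone : {fmonom I}).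
Proof. exact: rmorphM. Qed.

Lemma sbracket_counit (O : set free_alg) x y :
  x@_(mone : {fmonom I}) = 0 -> (sbracket O x y)@_(mone : {fmonom I}) = 0.
Proof.
by move=> x0; rewrite /sbracket mcoeffB !counitM x0 mulr0 mul0r mulr0 subr0.
Qed.

Context (rel : set free_alg).

Definition rel_ideal : set free_alg := smallest two_sided_ideal rel.

Lemma rel_ideal0 : rel_ideal 0.
Proof. by move=> J [[]]. Qed.

Lemma rel_idealD x y : rel_ideal x -> rel_ideal y -> rel_ideal (x + y).
Proof.
move=> Jx Jy J JJ; have [[_ JD _] _] := JJ.
by apply: JD; [exact: Jx|exact: Jy].
Qed.

Lemma rel_idealM a x b : rel_ideal x -> rel_ideal (a * x * b).
Proof. by move=> Jx J JJ; have [[_ _ JM] _] := JJ; apply: JM; exact: Jx. Qed.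

Lemma rel_idealMl a x : rel_ideal x -> rel_ideal (a * x).
Proof. by move=> /(rel_idealM a 1); rewrite mulr1. Qed.

Lemma rel_idealMr x b : rel_ideal x -> rel_ideal (x * b).
Proof. by move=> /(rel_idealM 1 b); rewrite mul1r. Qed.

Lemma rel_idealN x : rel_ideal x -> rel_ideal (- x).
Proof. by move=> /(rel_idealMl (-1)); rewrite mulN1r. Qed.

Definition ideal_equiv (x y : free_alg) : bool := `[< rel_ideal (x - y) >].

Lemma ideal_equivP : equiv_class_of ideal_equiv.
Proof.
split=> [x|x y|y x z].
- by apply/asboolP; rewrite subrr; exact: rel_ideal0.
- by apply/asboolP/asboolP => /rel_idealN; rewrite opprB.
- move=> /asboolP xy /asboolP yz; apply/asboolP.
  by have := rel_idealD xy yz; rewrite addrA subrK.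
Qed.

Canonical ideal_equiv_equiv := EquivRelPack ideal_equivP.

Definition presented : Type := {eq_quot ideal_equiv}.
HB.instance Definition _ := Choice.on presented.
HB.instance Definition _ := EqQuotient.on presented.

Implicit Types (u v w : presented) (x y : free_alg).

Definition pr_zero : presented := \pi_presented 0.
Definition pr_one : presented := \pi_presented 1.
Definition pr_opp u : presented := \pi_presented (- repr u).
Definition pr_add u v : presented := \pi_presented (repr u + repr v).
Definition pr_mul u v : presented := \pi_presented (repr u * repr v).
Definition pr_scale (c : K) u : presented := \pi_presented (c *: repr u).

Lemma pr_eqP x y : \pi_presented x = \pi_presented y <-> rel_ideal (x - y).
Proof.
split=> [/eqmodP xy|xy]; first exact/asboolP.
by apply/eqmodP; apply/asboolP.
Qed.

Lemma pr_repr x : rel_ideal (repr (\pi_presented x) - x).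
Proof. by apply/pr_eqP; rewrite reprK. Qed.

Lemma pr_oppE x : pr_opp (\pi_presented x) = \pi_presented (- x).
Proof.
apply/pr_eqP; rewrite -opprD; apply: rel_idealN; exact: pr_repr.
Qed.

Lemma pr_addE x y :
  pr_add (\pi_presented x) (\pi_presented y) = \pi_presented (x + y).
Proof.
by apply/pr_eqP; rewrite opprD addrACA; apply: rel_idealD; apply: pr_repr.
Qed.

Lemma pr_mulE x y :
  pr_mul (\pi_presented x) (\pi_presented y) = \pi_presented (x * y).
Proof.
apply/pr_eqP; set x' := repr _; set y' := repr _.
have -> : x' * y' - x * y = (x' - x) * y' + x * (y' - y).
  by rewrite mulrBl mulrBr addrA subrK.
by apply: rel_idealD; [apply: rel_idealMr|apply: rel_idealMl]; apply: pr_repr.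
Qed.

Lemma pr_scaleE c x : pr_scale c (\pi_presented x) = \pi_presented (c *: x).
Proof.
apply/pr_eqP; rewrite -scalerBr -[_ - _]mul1r scalerAl.
by apply: rel_idealMl; apply: pr_repr.
Qed.

Lemma pr_addA : associative pr_add.
Proof.
elim/quotW=> x; elim/quotW=> y; elim/quotW=> z.
rewrite (pr_addE y z) (pr_addE x (y + z)) (pr_addE x y) (pr_addE (x + y) z).
by rewrite addrA.
Qed.

Lemma pr_addC : commutative pr_add.
Proof.
by elim/quotW=> x; elim/quotW=> y; rewrite (pr_addE x y) (pr_addE y x) addrC.
Qed.

Lemma pr_add0 : left_id pr_zero pr_add.
Proof. by elim/quotW=> x; rewrite (pr_addE 0 x) add0r. Qed.

Lemma pr_addN : left_inverse pr_zero pr_opp pr_add.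
Proof. by elim/quotW=> x; rewrite (pr_oppE x) (pr_addE (- x) x) addNr. Qed.

Lemma pr_mulA : associative pr_mul.
Proof.
elim/quotW=> x; elim/quotW=> y; elim/quotW=> z.
rewrite (pr_mulE y z) (pr_mulE x (y * z)) (pr_mulE x y) (pr_mulE (x * y) z).
by rewrite mulrA.
Qed.

Lemma pr_mul1 : left_id pr_one pr_mul.
Proof. by elim/quotW=> x; rewrite (pr_mulE 1 x) mul1r. Qed.

Lemma pr_mulr1 : right_id pr_one pr_mul.
Proof. by elim/quotW=> x; rewrite (pr_mulE x 1) mulr1. Qed.

Lemma pr_mulDl : left_distributive pr_mul pr_add.
Proof.
elim/quotW=> x; elim/quotW=> y; elim/quotW=> z.
rewrite (pr_addE x y) (pr_mulE (x + y) z) (pr_mulE x z) (pr_mulE y z).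
by rewrite (pr_addE (x * z)) mulrDl.
Qed.

Lemma pr_mulDr : right_distributive pr_mul pr_add.
Proof.
elim/quotW=> x; elim/quotW=> y; elim/quotW=> z.
rewrite (pr_addE y z) (pr_mulE x (y + z)) (pr_mulE x y) (pr_mulE x z).
by rewrite (pr_addE (x * y)) mulrDr.
Qed.

HB.instance Definition _ := GRing.isPzRing.Build presented
  pr_addA pr_addC pr_add0 pr_addN pr_mulA pr_mul1 pr_mulr1 pr_mulDl pr_mulDr.

Lemma pr_scaleA c d u : pr_scale c (pr_scale d u) = pr_scale (c * d) u.
Proof.
elim/quotW: u => x.
by rewrite (pr_scaleE d x) (pr_scaleE c (d *: x)) (pr_scaleE _ x) scalerA.
Qed.

Lemma pr_scale1 : left_id 1 pr_scale.
Proof. by elim/quotW=> x; rewrite (pr_scaleE 1 x) scale1r. Qed.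

Lemma pr_scaleDr : right_distributive pr_scale +%R.
Proof.
move=> c; elim/quotW=> x; elim/quotW=> y; rewrite /GRing.add /=.
rewrite (pr_addE x y) (pr_scaleE c (x + y)) (pr_scaleE c x) (pr_scaleE c y).
by rewrite (pr_addE (c *: x)) scalerDr.
Qed.

Lemma pr_scaleDl u : {morph pr_scale^~ u : c d / c + d}.
Proof.
move=> c d; elim/quotW: u => x; rewrite [RHS]/GRing.add /=.
rewrite (pr_scaleE _ x) (pr_scaleE c x) (pr_scaleE d x).
by rewrite (pr_addE (c *: x)) scalerDl.
Qed.

HB.instance Definition _ := GRing.Zmodule_isLmodule.Build K presented
  pr_scaleA pr_scale1 pr_scaleDr pr_scaleDl.

Lemma pr_scaleAl c u v : c *: (u * v) = (c *: u) * v.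
Proof.
elim/quotW: u => x; elim/quotW: v => y; rewrite /GRing.scale /GRing.mul /=.
rewrite (pr_mulE x y) (pr_scaleE c (x * y)) (pr_scaleE c x).
by rewrite (pr_mulE (c *: x)) scalerAl.
Qed.

Lemma pr_scaleAr c u v : c *: (u * v) = u * (c *: v).
Proof.
elim/quotW: u => x; elim/quotW: v => y; rewrite /GRing.scale /GRing.mul /=.
rewrite (pr_mulE x y) (pr_scaleE c (x * y)) (pr_scaleE c y).
by rewrite (pr_mulE x (c *: y)) malg_scaleAr.
Qed.

Lemma presented_neq0 :
  (forall x, rel x -> x@_(mone : {fmonom I}) = 0) -> 1 != 0 :> presented.
Proof.
move=> rel0; apply/eqP => /pr_eqP; rewrite subr0.
pose J := [set x : free_alg | x@_(mone : {fmonom I}) = 0].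
move=> /(_ J) /=; rewrite /J /= mcoeff1 eqxx /= => H.
suff /H /eqP : two_sided_ideal J /\ rel `<=` J by rewrite oner_eq0.
rewrite /J; split=> [|x /rel0 //]; split=> /= [|x y x0 y0|a x b x0].
- by rewrite mcoeff0.
- by rewrite mcoeffD x0 y0 addr0.
- by rewrite !counitM x0 mulr0 mul0r.
Qed.

End Presentation.

Section PowerSeries.
Context (K : fieldType) (A : algType K).

Record fps : Type := Fps { fcoef : nat -> A }.

Implicit Types (x y z : fps).

Lemma fpsP x y : (forall n, fcoef x n = fcoef y n) -> x = y.
Proof. by case: x => x; case: y => y /= xy; congr Fps; apply/funext. Qed.

HB.instance Definition _ := gen_eqMixin fps.
HB.instance Definition _ := gen_choiceMixin fps.

Definition fps0 := Fps (fun=> 0).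
Definition fps1 := Fps (fun n => (n == 0)%:R).
Definition fps_opp x := Fps (fun n => - fcoef x n).
Definition fps_add x y := Fps (fun n => fcoef x n + fcoef y n).
Definition fps_mul x y :=
  Fps (fun n => \sum_(i < n.+1) fcoef x i * fcoef y (n - i)).
Definition fps_scale (c : K) x := Fps (fun n => c *: fcoef x n).

Lemma fps_addA : associative fps_add.
Proof. by move=> x y z; apply: fpsP => n /=; rewrite addrA. Qed.

Lemma fps_addC : commutative fps_add.
Proof. by move=> x y; apply: fpsP => n /=; rewrite addrC. Qed.

Lemma fps_add0 : left_id fps0 fps_add.
Proof. by move=> x; apply: fpsP => n /=; rewrite add0r. Qed.

Lemma fps_addN : left_inverse fps0 fps_opp fps_add.
Proof. by move=> x; apply: fpsP => n /=; rewrite addNr. Qed.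

Lemma fps_mulE x y n :
  fcoef (fps_mul x y) n = \sum_(i < n.+1) fcoef x i * fcoef y (n - i).
Proof. by []. Qed.

Lemma fps_mul_rev x y n :
  fcoef (fps_mul x y) n = \sum_(i < n.+1) fcoef x (n - i) * fcoef y i.
Proof.
rewrite /= (reindex_inj rev_ord_inj) /=.
by apply: eq_bigr => i _; rewrite subSS subKn ?leq_ord.
Qed.

Lemma fps_mulA : associative fps_mul.
Proof.
move=> x y z; apply: fpsP => i; rewrite [RHS]fps_mul_rev [LHS]fps_mulE.
pose coef3 j k := fcoef x j * (fcoef y (i - j - k) * fcoef z k).
transitivity (\sum_(j < i.+1) \sum_(k < i.+1 | (k <= i - j)%N) coef3 j k).
  apply: eq_bigr => j _; rewrite fps_mul_rev.
  by rewrite big_distrr /= (big_ord_narrow_leq (leq_subr _ _)).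
rewrite (exchange_big_dep predT) //=; apply: eq_bigr => k _.
transitivity (\sum_(j < i.+1 | (j <= i - k)%N) coef3 j k).
  apply: eq_bigl => j; rewrite -ltnS -(ltnS j) -!subSn ?leq_ord //.
  by rewrite -subn_gt0 -(subn_gt0 j) -!subnDA addnC.
rewrite (big_ord_narrow_leq (leq_subr _ _)) big_distrl /=.
by apply: eq_bigr => j _; rewrite /coef3 -!subnDA addnC mulrA.
Qed.

Lemma fps_mul1 : left_id fps1 fps_mul.
Proof.
move=> x; apply: fpsP => n /=; rewrite big_ord_recl subn0 mul1r.
by rewrite big1 ?addr0 // => i _; rewrite mul0r.
Qed.

Lemma fps_mulr1 : right_id fps1 fps_mul.
Proof.
move=> x; apply: fpsP => n; rewrite fps_mul_rev big_ord_recl subn0 mulr1.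
by rewrite big1 ?addr0 // => i _; rewrite mulr0.
Qed.

Lemma fps_mulDl : left_distributive fps_mul fps_add.
Proof.
move=> x y z; apply: fpsP => n /=; rewrite -big_split /=.
by apply: eq_bigr => i _; rewrite mulrDl.
Qed.

Lemma fps_mulDr : right_distributive fps_mul fps_add.
Proof.
move=> x y z; apply: fpsP => n /=; rewrite -big_split /=.
by apply: eq_bigr => i _; rewrite mulrDr.
Qed.

Lemma fps1_neq0 : fps1 != fps0.
Proof.
by apply/eqP => /(congr1 (fcoef^~ 0%N)) /eqP; rewrite /= oner_eq0.
Qed.

HB.instance Definition _ := GRing.isNzRing.Build fps
  fps_addA fps_addC fps_add0 fps_addN fps_mulA fps_mul1 fps_mulr1
  fps_mulDl fps_mulDr fps1_neq0.

Lemma fps_scaleA c d x : fps_scale c (fps_scale d x) = fps_scale (c * d) x.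
Proof. by apply: fpsP => n /=; rewrite scalerA. Qed.

Lemma fps_scale1 : left_id 1 fps_scale.
Proof. by move=> x; apply: fpsP => n /=; rewrite scale1r. Qed.

Lemma fps_scaleDr : right_distributive fps_scale +%R.
Proof. by move=> c x y; apply: fpsP => n /=; rewrite scalerDr. Qed.

Lemma fps_scaleDl x : {morph fps_scale^~ x : c d / c + d}.
Proof. by move=> c d; apply: fpsP => n /=; rewrite scalerDl. Qed.

HB.instance Definition _ := GRing.Zmodule_isLmodule.Build K fps
  fps_scaleA fps_scale1 fps_scaleDr fps_scaleDl.

Lemma fps_scaleAl c x y : c *: (x * y) = (c *: x) * y.
Proof.
apply: fpsP => n /=; rewrite scaler_sumr.
by apply: eq_bigr => i _; rewrite scalerAl.
Qed.

HB.instance Definition _ := GRing.Lmodule_isLalgebra.Build K fps fps_scaleAl.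

Lemma fps_scaleAr c x y : c *: (x * y) = x * (c *: y).
Proof.
apply: fpsP => n /=; rewrite scaler_sumr.
by apply: eq_bigr => i _; rewrite scalerAr.
Qed.

HB.instance Definition _ := GRing.Lalgebra_isAlgebra.Build K fps fps_scaleAr.

Definition fps_const (a : A) : fps := Fps (fun n => a *+ (n == 0)).

(* The limit h -> 0 of a formal power series: its reduction modulo h. *)
Definition at_h0 (x : fps) : A := fcoef x 0.

Definition hbar : fps := Fps (fun n => (n == 1)%:R).

(* The image in A[[h]] of the scalar power series c_0 + c_1 h + ... of K[[h]],
   through which A[[h]] is a K[[h]]-algebra. *)
Definition fps_scalar (c : nat -> K) : fps := Fps (fun n => (c n)%:A).

(* The square root of a series x with constant coefficient 1: its coefficients
   solve the equations \sum_(i <= n) s_i s_(n-i) = x_n recursively; see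
   [fps_sqrtP] and [fps_sqrt_uniq]. *)
Fixpoint sqrt_coefs (x : fps) (n : nat) : seq A :=
  if n is m.+1 then
    let s := sqrt_coefs x m in
    rcons s (2^-1 *: (fcoef x m.+1 - \sum_(1 <= i < m.+1) s`_i * s`_(m.+1 - i)))
  else [:: 1].

Definition fps_sqrt (x : fps) : fps := Fps (fun n => (sqrt_coefs x n)`_n).

Lemma size_sqrt_coefs x n : size (sqrt_coefs x n) = n.+1.
Proof. by elim: n => //= n IHn; rewrite size_rcons IHn. Qed.

Lemma nth_sqrt_coefs x n i : (i <= n)%N ->
  (sqrt_coefs x n)`_i = fcoef (fps_sqrt x) i.
Proof.
elim: n => [|n IHn]; first by case: i.
rewrite leq_eqVlt => /predU1P [->//|i_le_n].
by rewrite /= nth_rcons size_sqrt_coefs i_le_n IHn.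
Qed.

Lemma fps_sqrtS x n : fcoef (fps_sqrt x) n.+1 =
  2^-1 *: (fcoef x n.+1 -
    \sum_(1 <= i < n.+1) fcoef (fps_sqrt x) i * fcoef (fps_sqrt x) (n.+1 - i)).
Proof.
rewrite [LHS]/= nth_rcons size_sqrt_coefs ltnn eqxx; congr (_ *: (_ - _)).
apply: eq_big_nat => -[|i] //= i_lt_n.
by rewrite !nth_sqrt_coefs // leq_subLR addSn ltnS leq_addl.
Qed.

Lemma fps_mul_ends x y n : fcoef (x * y) n.+1 =
  fcoef x 0 * fcoef y n.+1 + fcoef x n.+1 * fcoef y 0 +
  \sum_(1 <= i < n.+1) fcoef x i * fcoef y (n.+1 - i).
Proof.
rewrite /= -(big_mkord xpredT (fun i => fcoef x i * fcoef y (n.+1 - i))).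
rewrite big_nat_recr //= big_nat_recl //= subn0 subnn -!addrA; congr (_ + _).
by rewrite addrC big_add1.
Qed.

Lemma fps_sqrtP x : 2 != 0 :> K -> fcoef x 0 = 1 ->
  fcoef (fps_sqrt x) 0 = 1 /\ fps_sqrt x * fps_sqrt x = x.
Proof.
move=> nz2 x0; split=> //; apply: fpsP => -[|n].
  by rewrite /= big_ord1 /= mulr1 x0.
rewrite fps_mul_ends mul1r mulr1 fps_sqrtS -mulr2n -scaler_nat scalerA.
by rewrite divff // scale1r subrK.
Qed.

Lemma fps_sqrt_uniq x s : 2 != 0 :> K ->
  fcoef s 0 = 1 -> s * s = x -> s = fps_sqrt x.
Proof.
move=> nz2 s0 sx; apply: fpsP => n; have [m] := ubnP n.
elim: m n => // m IHm [|n] n_lt_m; first by rewrite s0.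
rewrite fps_sqrtS -[in fcoef x _]sx fps_mul_ends s0 mul1r mulr1.
rewrite [X in _ - X](_ : _ =
    \sum_(1 <= i < n.+1) fcoef s i * fcoef s (n.+1 - i)).
  by rewrite addrK -mulr2n -scaler_nat scalerA mulVf // scale1r.
apply: eq_big_nat => i /andP [i_gt0 i_lt_n].
rewrite !IHm //; last exact: leq_trans i_lt_n n_lt_m.
move: n_lt_m; rewrite ltnS => /(leq_trans _); apply; rewrite ltnS leq_subLR.
by case: i i_gt0 {i_lt_n} => // i _; rewrite addSn ltnS leq_addl.
Qed.

End PowerSeries.

Arguments hbar {K A}.
Arguments fps_scalar {K A}.

Definition complexes (R : realType) : numClosedFieldType := R[i].

Section Sl21.
Context (R : realType).
Local Notation C := (complexes R).

(* The three summands index the h_i, the e_i and the f_i; the ordinals 0 and 1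
   of 'I_2 stand for the subscripts 1 and 2 of the Chevalley generators. *)
Definition sl21_idx : finType := ('I_2 + 'I_2 + 'I_2)%type.

Definition sl21_odd (g : sl21_idx) : bool :=
  match g with
  | inl (inl _) => false
  | inl (inr i) => i == 1
  | inr i => i == 1
  end.

Local Notation F := {malg C[{fmonom sl21_idx}]}.

Definition free_h (i : 'I_2) : F := free_gen C (inl (inl i) : sl21_idx).
Definition free_e (i : 'I_2) : F := free_gen C (inl (inr i) : sl21_idx).
Definition free_f (i : 'I_2) : F := free_gen C (inr i : sl21_idx).

Definition cartan (i j : 'I_2) : C :=
  if i != j then -1 else if i == 0 then 2 else 0.

Definition free_br : F -> F -> F := sbracket (free_part sl21_odd true).

Inductive sl21_rel : set F :=
  | rel_hh i j : sl21_rel (free_br (free_h i) (free_h j))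
  | rel_he i j :
      sl21_rel (free_br (free_h i) (free_e j) - cartan i j *: free_e j)
  | rel_hf i j :
      sl21_rel (free_br (free_h i) (free_f j) + cartan i j *: free_f j)
  | rel_ef i j :
      sl21_rel (free_br (free_e i) (free_f j) - (i == j)%:R *: free_h i)
  | rel_ee : sl21_rel (free_br (free_e 1) (free_e 1))
  | rel_ff : sl21_rel (free_br (free_f 1) (free_f 1))
  | rel_eee : sl21_rel (free_br (free_e 0) (free_br (free_e 0) (free_e 1)))
  | rel_fff : sl21_rel (free_br (free_f 0) (free_br (free_f 0) (free_f 1))).

Definition Usl21 : Type := presented sl21_rel.

HB.instance Definition _ := GRing.PzRing.on Usl21.
HB.instance Definition _ := GRing.Lmodule.on Usl21.

Lemma sl21_rel_counit x : sl21_rel x -> x@_(mone : {fmonom sl21_idx}) = 0.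
Proof.
have gen0 g : (free_gen C (g : sl21_idx))@_(mone : {fmonom sl21_idx}) = 0.
  by rewrite mcoeffU1 fm1_eq1.
have br0 O y g : (sbracket O (free_gen C g) y)@_(mone : {fmonom sl21_idx}) = 0.
  exact/sbracket_counit/gen0.
case=> [i j|i j|i j|i j||||]; first exact: br0.
- by rewrite mcoeffB br0 mcoeffZ gen0 mulr0 subr0.
- by rewrite mcoeffD br0 mcoeffZ gen0 mulr0 addr0.
- by rewrite mcoeffB br0 mcoeffZ gen0 mulr0 subr0.
all: exact: br0.
Qed.

Lemma Usl21_neq0 : 1 != 0 :> Usl21.
Proof. exact: presented_neq0 sl21_rel_counit. Qed.

HB.instance Definition _ := GRing.PzSemiRing_isNonZero.Build Usl21 Usl21_neq0.
HB.instance Definition _ := GRing.Lmodule_isLalgebra.Build C Usl21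
  (@pr_scaleAl _ _ sl21_rel).
HB.instance Definition _ := GRing.Lalgebra_isAlgebra.Build C Usl21
  (@pr_scaleAr _ _ sl21_rel).

Definition Usl21_part (b : bool) : set Usl21 :=
  [set \pi_(presented sl21_rel) x | x in free_part sl21_odd b].

Definition h_1 : Usl21 := \pi_(presented sl21_rel) (free_h 0).
Definition h_2 : Usl21 := \pi_(presented sl21_rel) (free_h 1).
Definition e_1 : Usl21 := \pi_(presented sl21_rel) (free_e 0).
Definition e_2 : Usl21 := \pi_(presented sl21_rel) (free_e 1).
Definition f_1 : Usl21 := \pi_(presented sl21_rel) (free_f 0).
Definition f_2 : Usl21 := \pi_(presented sl21_rel) (free_f 1).

Definition h_3 : Usl21 := h_1 + h_2.
Definition e_3 : Usl21 := e_1 * e_2 - e_2 * e_1.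
Definition f_3 : Usl21 := f_2 * f_1 - f_1 * f_2.

Definition Uh : Type := fps Usl21.
HB.instance Definition _ := GRing.Algebra.on Uh.

Definition Uh_part (b : bool) : set Uh :=
  [set x | forall n, Usl21_part b (fcoef x n)].

(* A Z/2-grading of the C[[h]]-algebra U[[h]], given by its even (false) and
   odd (true) homogeneous parts, which are C[[h]]-submodules. *)
Definition is_superalgebra_grading (G : bool -> set Uh) : Prop :=
  [/\ forall b x y, G b x -> G b y -> G b (x + y),
      forall b c x, G b x -> G b (fps_scalar c * x),
      forall x, exists! p : Uh * Uh,
        [/\ G false p.1, G true p.2 & x = p.1 + p.2]
    & forall a b x y, G a x -> G b y -> G (a (+) b) (x * y)].

Definition is_Ch_subalgebra (S : set Uh) : Prop :=
  [/\ S 1, forall x y, S x -> S y -> S (x + y),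
      forall x y, S x -> S y -> S (x * y)
    & forall c x, S x -> S (fps_scalar c * x)].

(* The C[[h]]-subalgebra generated by S is dense for the h-adic topology. *)
Definition hadically_generates (S : set Uh) : Prop :=
  forall (x : Uh) (n : nat), exists2 y, smallest is_Ch_subalgebra S y
    & forall i, (i < n)%N -> fcoef y i = fcoef x i.

Local Notation h := (hbar : Uh).
Local Notation "x %:h" := (fps_const x : Uh) (at level 2).

Definition sqrt_1_h2e2 : Uh := fps_sqrt (1 + h ^+ 2 * e_1%:h ^+ 2).

Definition dT : Uh := h * e_1%:h + sqrt_1_h2e2.
Definition dTinv : Uh := - (h * e_1%:h) + sqrt_1_h2e2.
Definition dH1 : Uh := sqrt_1_h2e2 * h_1%:h.
Definition dF1 : Uh := f_1%:h - 4^-1 *: (h ^+ 2 * e_1%:h * (h_1%:h ^+ 2 - 1)).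
Definition dH2 : Uh := h_2%:h - 2^-1 *: (h ^+ 2 * e_1%:h ^+ 2 * h_1%:h).
Definition dE2 : Uh :=
  e_2%:h - 4^-1 *: (h ^+ 2 * e_1%:h * e_3%:h * (2 * h_1%:h + 1)).
Definition dF2 : Uh := f_2%:h.
Definition dH3 : Uh := h_3%:h + 2^-1 *: (h ^+ 2 * e_1%:h ^+ 2 * h_1%:h).
Definition dE3 : Uh := e_3%:h.
Definition dF3 : Uh :=
  f_3%:h + 4^-1 *: (h ^+ 2 * e_1%:h * f_2%:h * (2 * h_1%:h + 1)).

End Sl21.

(* Main.v *)
From HB Require Import structures.
From Stdlib Require Import ZArith.
Require Import Defs.
From mathcomp Require Import all_boot all_order all_algebra.
From mathcomp Require Import boolp classical_sets reals.
From mathcomp Require Import complex monalg ssrZ.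

Set Implicit Arguments.
Unset Strict Implicit.
Unset Printing Implicit Defensive.

Import GRing.Theory Num.Theory.
Local Open Scope ring_scope.
Local Open Scope classical_set_scope.
Local Open Scope quotient_scope.

(** The nonlinear map only involves e_1 through the commuting elements
    t = h e_1, s = sqrt(1 + t^2) and u = 1/s: indeed T = t + s, T^-1 = s - t,
    T - T^-1 = 2t and T + T^-1 = 2s. Hence each relation is an identity
    between noncommutative polynomials in h, t, s, u and the PBW generators of
    sl(2|1), and it can be decided by putting both sides in PBW order. The
    reordering rules come from three sources.

    - Among the generators of sl(2|1), with e_3 and f_3 included, they follow
      from the Chevalley-Serre relations ([pbw_sound]). Serre enters only for
      the commutators [e_1, e_3], [f_1, f_3] and the squares of e_3, f_3.
    - Between t and a generator y, they are h times the rule for e_1.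
    - Between s and y, differentiating s^2 = 1 + t^2 along the inner derivation
      D = [., y] gives s D(s) + D(s) s = t D(t) + D(t) t. As s has constant
      term 1, the map d |-> s d + d s is injective on U[[h]], so this equation
      determines D(s), and it is enough to verify a closed formula for it
      ([comm_s], [s_sound]); for instance [f_1, s] = - h t u h_1 - h t u^3.

    The resulting table ([deformed_sound], [series_deformed_sound]) decides all
    the relations through a verified normalisation procedure ([nc_checkP]).

    The remaining claims are structural. The parity automorphism of U, well
    defined because the relations are homogeneous, shows that an element both
    even and odd vanishes, hence that U and U[[h]] are graded
    ([Usl21_part_disjoint], [Uh_part_grading]). The three-dimensional
    representation shows that no generator vanishes, so that each has exactly
    one parity ([Usl21_gens_neq0], [gens_parity]). Modulo h, five of the
    Chevalley generators are deformed generators and e_1 is the bracket of F_2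
    and E_3, so that U[[h]] is generated by successive approximation
    ([deformed_generates]). Finally, the homogeneous parts of a grading G are
    C[[h]]-submodules, so its projections commute with h and are h-adically
    continuous; they agree with the parity projections on the dense subalgebra
    generated by the generators, hence everywhere ([grading_unique]). *)

(** * Deciding identities in an associative algebra by rewriting *)

(** A letter is a natural number, interpreted by a valuation; the scalar of
    [NScale] is a dyadic rational (see [dyadic]). *)
Inductive ncexpr :=
  | NVar of nat
  | NNat of nat
  | NAdd of ncexpr & ncexpr
  | NOpp of ncexpr
  | NMul of ncexpr & ncexpr
  | NExp of ncexpr & nat
  | NScale of Z * nat & ncexpr.

(** The pair (z, k) stands for z / 2^k. Only powers of 2 occur as denominators
    in the nonlinear map, and this form needs no reduction to be tested
    for 0. *)
Definition dyadic : Type := (Z * nat)%type.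
Definition word := seq nat.
Definition ncpoly := seq (dyadic * word).

Definition dadd (c d : dyadic) : dyadic :=
  if (c.2 <= d.2)%N then (c.1 * 2%:R ^+ (d.2 - c.2) + d.1, d.2)
  else (c.1 + d.1 * 2%:R ^+ (c.2 - d.2), c.2).
Definition dmul (c d : dyadic) : dyadic := (c.1 * d.1, (c.2 + d.2)%N).
Definition dnat (n : nat) : dyadic := (Z.of_nat n, 0%N).

Fixpoint padd1 (t : dyadic * word) (p : ncpoly) : ncpoly :=
  if p is t' :: p' then
    if t.2 == t'.2 then (dadd t.1 t'.1, t.2) :: p' else t' :: padd1 t p'
  else [:: t].
Definition padd (p q : ncpoly) : ncpoly := foldr padd1 q p.
Definition pscale (c : dyadic) (p : ncpoly) : ncpoly :=
  [seq (dmul c t.1, t.2) | t <- p].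

(** The linear extension of a map defined on words. *)
Definition plin (f : word -> ncpoly) (p : ncpoly) : ncpoly :=
  foldr (fun t => padd (pscale t.1 (f t.2))) [::] p.

Section Normalisation.
Variable rules : seq (nat * nat * ncpoly).

Definition rule_for (a b : nat) : option ncpoly :=
  ohead [seq r.2 | r <- rules & r.1 == (a, b)].

(** Normal form of the product of the letter a by the normal word w: only the
    product of a by the first letter of w can be reducible, and the letters of
    the words that replace it are in turn multiplied from right to left. Like
    terms are collected at each step, which keeps the intermediate polynomials
    small. The fuel n bounds the depth of the recursion; when it runs out the
    result is still correct, but possibly not reduced. *)
Fixpoint lmul (n : nat) (a : nat) (w : word) : ncpoly :=
  match n, w with
  | n'.+1, b :: w' =>
    if rule_for a b is Some p then
      plin (foldr (fun a' => plin (lmul n' a')) [:: (dnat 1, w')]) p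
    else [:: (dnat 1, a :: w)]
  | _, _ => [:: (dnat 1, a :: w)]
  end.

Definition wmul (n : nat) (w : word) (q : ncpoly) : ncpoly :=
  foldr (fun a => plin (lmul n a)) q w.
Definition pmul (n : nat) (p q : ncpoly) : ncpoly :=
  plin (fun w => wmul n w q) p.

Fixpoint norm (n : nat) (e : ncexpr) : ncpoly :=
  match e with
  | NVar a => [:: (dnat 1, [:: a])]
  | NNat k => [:: (dnat k, [::])]
  | NAdd e1 e2 => padd (norm n e1) (norm n e2)
  | NOpp e1 => pscale (Z.opp 1, 0%N) (norm n e1)
  | NMul e1 e2 => pmul n (norm n e1) (norm n e2)
  | NExp e1 k => iter k (pmul n (norm n e1)) [:: (dnat 1, [::])]
  | NScale c e1 => pscale c (norm n e1)
  end.

End Normalisation.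

Section Soundness.
Variables (K : numFieldType) (A : algType K) (x : nat -> A).

Definition zval (z : Z) : K := (int_of_Z z)%:~R.
Definition dval (c : dyadic) : K := zval c.1 * 2^-1 ^+ c.2.
Definition wval (w : word) : A := \prod_(a <- w) x a.
Definition pval (p : ncpoly) : A := \sum_(t <- p) dval t.1 *: wval t.2.

Fixpoint eval (e : ncexpr) : A :=
  match e with
  | NVar a => x a
  | NNat k => k%:R
  | NAdd e1 e2 => eval e1 + eval e2
  | NOpp e1 => - eval e1
  | NMul e1 e2 => eval e1 * eval e2
  | NExp e1 k => eval e1 ^+ k
  | NScale c e1 => dval c *: eval e1
  end.

Lemma zvalD a b : zval (a + b) = zval a + zval b.
Proof. by rewrite /zval !rmorphD. Qed.

Lemma zvalM a b : zval (a * b) = zval a * zval b.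
Proof. by rewrite /zval !rmorphM. Qed.

Lemma zval_exp2 k : zval (2%:R ^+ k) * 2^-1 ^+ k = 1.
Proof.
elim: k => [|k IHk]; first by rewrite /zval rmorph1 mulr1.
by rewrite !exprS zvalM mulrACA IHk mulr1 divff ?pnatr_eq0.
Qed.

Lemma dval_add c d : dval (dadd c d) = dval c + dval d.
Proof.
case: c d => [a m] [b n]; rewrite /dadd /dval /=.
have [le_mn|/ltnW le_nm] := leqP m n; rewrite /= zvalD zvalM mulrDl.
- by rewrite -{2}(subnKC le_mn) exprD mulrACA zval_exp2 mulr1.
- by rewrite -{3}(subnKC le_nm) exprD [X in _ + X]mulrACA zval_exp2 mulr1.
Qed.

Lemma dval_mul c d : dval (dmul c d) = dval c * dval d.
Proof. by rewrite /dval /= zvalM exprD mulrACA. Qed.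

Lemma dval_nat n : dval (dnat n) = n%:R.
Proof.
rewrite /dval /= expr0 mulr1 /zval.
suff -> : int_of_Z (Z.of_nat n) = n%:Z by [].
by case: n => //= n; rewrite SuccNat2Pos.id_succ.
Qed.

Lemma pval_add1 t p : pval (padd1 t p) = dval t.1 *: wval t.2 + pval p.
Proof.
rewrite /pval; elim: p => [|t' p IHp] /=.
  by rewrite big_seq1 big_nil addr0.
case: eqP => [tt'|_]; rewrite !big_cons /=; last by rewrite IHp addrCA.
by rewrite dval_add scalerDl -tt' addrA.
Qed.

Lemma pval_add p q : pval (padd p q) = pval p + pval q.
Proof.
elim: p => [|t p IHp] /=; first by rewrite /pval big_nil add0r.
by rewrite pval_add1 IHp [in RHS]/pval big_cons addrA.
Qed.

Lemma pval_scale c p : pval (pscale c p) = dval c *: pval p.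
Proof.
rewrite /pval big_map scaler_sumr; apply: eq_bigr => t _.
by rewrite dval_mul scalerA.
Qed.

Lemma pval_plin (f : word -> ncpoly) (y : A) p :
  (forall w, pval (f w) = y * wval w) -> pval (plin f p) = y * pval p.
Proof.
move=> fE; elim: p => [|t p IHp] /=; first by rewrite /pval big_nil mulr0.
rewrite pval_add pval_scale IHp fE [in RHS]/pval big_cons mulrDr.
by rewrite scalerAr.
Qed.

Lemma pval_word w : pval [:: (dnat 1, w)] = wval w.
Proof. by rewrite /pval big_seq1 dval_nat scale1r. Qed.

(** A rule (a, b, e) rewrites the product of the letters a and b into e. *)
Fixpoint sound_rules (rs : seq (nat * nat * ncexpr)) : Prop :=
  if rs is (a, b, e) :: rs' then x a * x b = eval e /\ sound_rules rs'
  else True.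

Lemma sound_rules_cat rs1 rs2 :
  sound_rules rs1 -> sound_rules rs2 -> sound_rules (rs1 ++ rs2).
Proof. by elim: rs1 => //= -[[a b] e] rs1 IH [-> /IH h] /h. Qed.

Section Rules.
Variable rules : seq (nat * nat * ncpoly).
Hypothesis rulesP : forall a b p, ((a, b), p) \in rules ->
  x a * x b = pval p.

Lemma rule_forP a b p : rule_for rules a b = Some p -> x a * x b = pval p.
Proof.
rewrite /rule_for => h; apply: rulesP; move: h.
elim: rules => //= -[[a' b'] p'] rs IH /=.
case: eqP => [[-> ->] /= [->]|_ /IH]; rewrite inE ?eqxx // => ->.
by rewrite orbT.
Qed.

Lemma pval_lmul n a w : pval (lmul rules n a w) = x a * wval w.
Proof.
elim: n a w => [|n IHn] a [|b w] //=; try by rewrite pval_word /wval big_cons.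
case rE: rule_for => [p|]; last by rewrite pval_word /wval big_cons.
rewrite [wval (b :: w)]/wval big_cons mulrA (rule_forP rE) -/(wval w) => {rE}.
have wmulE v : wval v * wval w =
    pval (foldr (fun a' => plin (lmul rules n a')) [:: (dnat 1, w)] v).
  elim: v => [|c v IHv] /=; first by rewrite pval_word /wval big_nil mul1r.
  by rewrite (pval_plin _ (IHn c)) -IHv /wval big_cons mulrA.
elim: p => [|t p IHp] /=; first by rewrite /pval !big_nil mul0r.
rewrite pval_add pval_scale IHp -wmulE [in RHS]/pval big_cons mulrDl.
by rewrite scalerAl.
Qed.

Lemma pval_mul n p q : pval (pmul rules n p q) = pval p * pval q.
Proof.
have wmulE w : pval (wmul rules n w q) = wval w * pval q.
  elim: w => [|c w IHw] /=; first by rewrite /wval big_nil mul1r.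
  by rewrite (pval_plin _ (pval_lmul n c)) IHw /wval big_cons mulrA.
rewrite /pmul; elim: p => [|t p IHp] /=; first by rewrite /pval !big_nil mul0r.
rewrite pval_add pval_scale IHp wmulE [in RHS]/pval big_cons mulrDl.
by rewrite scalerAl.
Qed.

Lemma pval_norm n e : pval (norm rules n e) = eval e.
Proof.
elim: e => /= [a|k|e1 <- e2 <-|e <-|e1 <- e2 <-|e <- k|c e <-].
- by rewrite pval_word /wval big_seq1.
- by rewrite /pval big_seq1 dval_nat /wval big_nil scaler_nat.
- exact: pval_add.
- by rewrite pval_scale /dval /= mulr1 scaleN1r.
- exact: pval_mul.
- elim: k => [|k IHk]; first by rewrite pval_word /wval big_nil.
  by rewrite iterS pval_mul IHk exprS.
- exact: pval_scale.
Qed.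
End Rules.

Definition compile :=
  map (fun r : nat * nat * ncexpr => (r.1, norm [::] 0 r.2)).

Definition nc_check rs n e1 e2 : bool :=
  all (fun t => Z.eqb t.1.1 0) (norm (compile rs) n (NAdd e1 (NOpp e2))).

(** Rewriting with sound rules preserves the value, so a difference all of whose
    coefficients reduce to 0 is 0. Termination and confluence of the rules only
    decide how many identities are proved in this way. *)
Theorem nc_checkP rs n e1 e2 :
  sound_rules rs -> nc_check rs n e1 e2 -> eval e1 = eval e2.
Proof.
move=> rsP chk; apply/eqP; rewrite -subr_eq0 -/(eval (NAdd e1 (NOpp e2))).
rewrite -(@pval_norm (compile rs) _ n); last first.
  move=> a b p; elim: rs rsP {chk} => //= -[[a' b'] e] rs IH /= [abE rsP].
  rewrite inE => /predU1P [[-> -> ->]|/(IH rsP)//].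
  by rewrite pval_norm.
rewrite /pval; move: chk; rewrite /nc_check.
elim: (norm _ _ _) => [|t p IHp] /=; first by rewrite big_nil.
move=> /andP[/Z.eqb_eq t0 /IHp].
by rewrite big_cons /dval t0 mul0r scale0r add0r.
Qed.
End Soundness.

(** * The reordering rules *)

(** The valuation of the letters: t is the third one, and e_3 and f_3 are
    letters of their own. *)
Definition letters (A : nzRingType) (h s u h1 h2 e1 e2 f1 f2 : A) : seq A :=
  let e3 := e1 * e2 - e2 * e1 in let f3 := f2 * f1 - f1 * f2 in
  [:: h; e1; h * e1; s; u; h1; h2; f1; e2; e3; f2; f3].

(** [nc P] proves an equation between terms built from the letters by
    normalising both sides with the rules whose soundness is P. The fuel 100
    suffices for all the identities below. *)
Ltac nc_letter env t n :=
  lazymatch env with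
  | ?u :: ?env' =>
    match constr:(Set) with
    | _ => let _ := match constr:(Set) with _ => constr_eq u t end in n
    | _ => nc_letter env' t constr:(S n)
    end
  end.

Ltac nc_reify env t :=
  lazymatch t with
  | @GRing.add _ ?a ?b =>
    let a' := nc_reify env a in let b' := nc_reify env b in constr:(NAdd a' b')
  | @GRing.opp _ ?a => let a' := nc_reify env a in constr:(NOpp a')
  | @GRing.mul _ ?a ?b =>
    let a' := nc_reify env a in let b' := nc_reify env b in constr:(NMul a' b')
  | @GRing.exp _ ?a ?k => let a' := nc_reify env a in constr:(NExp a' k)
  | @GRing.scale _ _ (dval _ ?c) ?a =>
    let a' := nc_reify env a in constr:(NScale c a')
  | @GRing.natmul _ (@GRing.one _) ?k => constr:(NNat k)
  | @GRing.one _ => constr:(NNat 1)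
  | @GRing.zero _ => constr:(NNat 0)
  | _ => let n := nc_letter env t 0%N in constr:(NVar n)
  end.

Ltac nc rsP :=
  lazymatch type of rsP with
  | @sound_rules ?K ?A (nth ?d ?env) ?rs =>
    let env := eval cbv beta zeta delta [letters] in env in
    lazymatch goal with |- @eq _ ?l ?r =>
      let e1 := nc_reify env l in let e2 := nc_reify env r in
      refine (@nc_checkP K A _ rs 100 e1 e2 rsP _);
      vm_compute; reflexivity
    end
  end.

Coercion NVar : nat >-> ncexpr.
Declare Scope nc_scope.
Delimit Scope nc_scope with nc.
Bind Scope nc_scope with ncexpr.
Notation "a + b" := (NAdd a b) : nc_scope.
Notation "- a" := (NOpp a) : nc_scope.
Notation "a - b" := (NAdd a (NOpp b)) : nc_scope.
Notation "a * b" := (NMul a b) : nc_scope.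
Notation "a ^ k" := (NExp a k) : nc_scope.
Notation "x ** y ~> e" := ((x, y) : nat * nat, e%nc : ncexpr)
  (at level 70, y at level 60, e at level 69).

Notation Xh := 0%N (only parsing).
Notation Xe1 := 1%N (only parsing).
Notation Xt := 2%N (only parsing).
Notation Xs := 3%N (only parsing).
Notation Xu := 4%N (only parsing).
Notation Xh1 := 5%N (only parsing).
Notation Xh2 := 6%N (only parsing).
Notation Xf1 := 7%N (only parsing).
Notation Xe2 := 8%N (only parsing).
Notation Xe3 := 9%N (only parsing).
Notation Xf2 := 10%N (only parsing).
Notation Xf3 := 11%N (only parsing).

(** The defining relations without Serre's, oriented along the triangular
    decomposition: Cartan elements go left, the f_i go right, and the words in
    the e_i alone, or in the f_i alone, are left untouched. This is what
    allows e_3 and f_3 to be expanded when their commutators are computed. *)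
Definition chevalley_rules : seq (nat * nat * ncexpr) := [::
  Xh2 ** Xh1 ~> Xh1 * Xh2;
  Xe1 ** Xh1 ~> Xh1 * Xe1 - NNat 2 * Xe1;
  Xe1 ** Xh2 ~> Xh2 * Xe1 + Xe1;
  Xe2 ** Xh1 ~> Xh1 * Xe2 + Xe2;
  Xe2 ** Xh2 ~> Xh2 * Xe2;
  Xf1 ** Xh1 ~> Xh1 * Xf1 + NNat 2 * Xf1;
  Xf1 ** Xh2 ~> Xh2 * Xf1 - Xf1;
  Xf2 ** Xh1 ~> Xh1 * Xf2 - Xf2;
  Xf2 ** Xh2 ~> Xh2 * Xf2;
  Xf1 ** Xe1 ~> Xe1 * Xf1 - Xh1;
  Xf1 ** Xe2 ~> Xe2 * Xf1;
  Xf2 ** Xe1 ~> Xe1 * Xf2;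
  Xf2 ** Xe2 ~> Xh2 - Xe2 * Xf2;
  Xe2 ** Xe2 ~> NNat 0;
  Xf2 ** Xf2 ~> NNat 0].

(** The PBW order is that of the letters. It starts with e_1, so that in a
    normal form the powers of e_1 stand next to those of h, t, s and u, with
    which they commute. *)
Definition pbw_rules : seq (nat * nat * ncexpr) := [::
  Xh1 ** Xe1 ~> Xe1 * Xh1 + NNat 2 * Xe1;
  Xh2 ** Xe1 ~> Xe1 * Xh2 - Xe1;
  Xf1 ** Xe1 ~> Xe1 * Xf1 - Xh1;
  Xe2 ** Xe1 ~> Xe1 * Xe2 - Xe3;
  Xe3 ** Xe1 ~> Xe1 * Xe3;
  Xf2 ** Xe1 ~> Xe1 * Xf2;
  Xf3 ** Xe1 ~> Xe1 * Xf3 + Xf2;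
  Xh2 ** Xh1 ~> Xh1 * Xh2;
  Xf1 ** Xh1 ~> Xh1 * Xf1 + NNat 2 * Xf1;
  Xf1 ** Xh2 ~> Xh2 * Xf1 - Xf1;
  Xe2 ** Xh1 ~> Xh1 * Xe2 + Xe2;
  Xe2 ** Xh2 ~> Xh2 * Xe2;
  Xe3 ** Xh1 ~> Xh1 * Xe3 - Xe3;
  Xe3 ** Xh2 ~> Xh2 * Xe3 + Xe3;
  Xf2 ** Xh1 ~> Xh1 * Xf2 - Xf2;
  Xf2 ** Xh2 ~> Xh2 * Xf2;
  Xf3 ** Xh1 ~> Xh1 * Xf3 + Xf3;
  Xf3 ** Xh2 ~> Xh2 * Xf3 - Xf3;
  Xe2 ** Xf1 ~> Xf1 * Xe2;
  Xe3 ** Xf1 ~> Xf1 * Xe3 - Xe2;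
  Xf2 ** Xf1 ~> Xf1 * Xf2 + Xf3;
  Xf3 ** Xf1 ~> Xf1 * Xf3;
  Xe2 ** Xe2 ~> NNat 0;
  Xe3 ** Xe3 ~> NNat 0;
  Xf2 ** Xf2 ~> NNat 0;
  Xf3 ** Xf3 ~> NNat 0;
  Xe3 ** Xe2 ~> - (Xe2 * Xe3);
  Xf3 ** Xf2 ~> - (Xf2 * Xf3);
  Xf2 ** Xe2 ~> Xh2 - Xe2 * Xf2;
  Xf3 ** Xe2 ~> Xf1 - Xe2 * Xf3;
  Xf2 ** Xe3 ~> Xe1 - Xe3 * Xf2;
  Xf3 ** Xe3 ~> Xh1 + Xh2 - Xe3 * Xf3].

Definition central_rules : seq (nat * nat * ncexpr) :=
  [seq a ** Xh ~> NVar Xh * NVar a | a <- iota 1 11].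

(** The commutative algebra generated by h, e_1, t, s and u. As polynomials in
    commuting variables, h e_1 - t, t^2 - s^2 + 1 and s u - 1 have pairwise
    coprime leading monomials h e_1, t^2 and s u for the lexicographic order
    with h > e_1 > t > s > u. They thus form a Groebner basis, and normal forms
    are unique. *)
Definition root_rules : seq (nat * nat * ncexpr) := [::
  Xh ** Xe1 ~> Xt;
  Xt ** Xe1 ~> Xe1 * Xt;
  Xs ** Xe1 ~> Xe1 * Xs;
  Xu ** Xe1 ~> Xe1 * Xu;
  Xs ** Xt ~> Xt * Xs;
  Xu ** Xt ~> Xt * Xu;
  Xt ** Xt ~> Xs * Xs - NNat 1;
  Xs ** Xu ~> NNat 1;
  Xu ** Xs ~> NNat 1].

Definition t_rules : seq (nat * nat * ncexpr) := [::
  Xh1 ** Xt ~> Xt * Xh1 + NNat 2 * Xt;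
  Xh2 ** Xt ~> Xt * Xh2 - Xt;
  Xf1 ** Xt ~> Xt * Xf1 - Xh * Xh1;
  Xe2 ** Xt ~> Xt * Xe2 - Xh * Xe3;
  Xe3 ** Xt ~> Xt * Xe3;
  Xf2 ** Xt ~> Xt * Xf2;
  Xf3 ** Xt ~> Xt * Xf3 + Xh * Xf2].

Definition s_rules : seq (nat * nat * ncexpr) := [::
  Xh1 ** Xs ~> Xs * Xh1 + NNat 2 * Xs - NNat 2 * Xu;
  Xh1 ** Xu ~> Xu * Xh1 - NNat 2 * Xu + NNat 2 * Xu ^ 3;
  Xh2 ** Xs ~> Xs * Xh2 - Xs + Xu;
  Xe3 ** Xs ~> Xs * Xe3;
  Xf2 ** Xs ~> Xs * Xf2;
  Xf1 ** Xs ~> Xs * Xf1 - Xh * Xt * Xu * Xh1 - Xh * Xt * Xu ^ 3;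
  Xe2 ** Xs ~> Xs * Xe2 - Xh * Xt * Xu * Xe3;
  Xf3 ** Xs ~> Xs * Xf3 + Xh * Xt * Xu * Xf2].

Definition deformed_rules :=
  central_rules ++ root_rules ++ pbw_rules ++ t_rules ++ s_rules.

Lemma double_inj (K : numFieldType) (A : lmodType K) (y : A) :
  y + y = 0 -> y = 0.
Proof.
move=> /eqP; rewrite -mulr2n -scaler_nat scaler_eq0 pnatr_eq0 /=.
by move=> /eqP.
Qed.

Section PBW.
Variables (K : numFieldType) (A : algType K) (h s u : A).
Variables (h1 h2 e1 e2 f1 f2 : A).

Local Notation e3 := (e1 * e2 - e2 * e1).
Local Notation f3 := (f2 * f1 - f1 * f2).
Local Notation x := (nth 0 (letters h s u h1 h2 e1 e2 f1 f2)).

Hypothesis chev : sound_rules x chevalley_rules.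
Hypothesis serre_e : e1 * e3 = e3 * e1.
Hypothesis serre_f : f1 * f3 = f3 * f1.

(** Since e_2^2 = 0, twice the square of e_3 is the anticommutator of e_2 with
    the Serre element [e_3, e_1]. *)
Lemma e3_sqr : e3 * e3 = 0.
Proof.
apply: (@double_inj K).
have -> : e3 * e3 + e3 * e3 =
    (e3 * e1 - e1 * e3) * e2 + e2 * (e3 * e1 - e1 * e3).
  by nc chev.
by rewrite serre_e subrr mul0r mulr0 addr0.
Qed.

Lemma f3_sqr : f3 * f3 = 0.
Proof.
apply: (@double_inj K).
have -> : f3 * f3 + f3 * f3 =
    (f1 * f3 - f3 * f1) * f2 + f2 * (f1 * f3 - f3 * f1).
  by nc chev.
by rewrite serre_f subrr mul0r mulr0 addr0.
Qed.

Lemma pbw_sound : sound_rules x pbw_rules.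
Proof.
rewrite /=; do !split=> //.
all: try by [rewrite serre_e|rewrite serre_f|rewrite e3_sqr|rewrite f3_sqr].
all: nc chev.
Qed.

Hypothesis hC : forall y, y * h = h * y.
Local Notation t := (h * e1).
Hypothesis s_sqr : s * s = 1 + t * t.
Hypothesis se1 : s * e1 = e1 * s.
Hypothesis su : s * u = 1.
Hypothesis us : u * s = 1.
Hypothesis s_anti_inj : forall y, s * y + y * s = 0 -> y = 0.

Lemma central_sound : sound_rules x central_rules.
Proof. by rewrite /= !(hC, mulrA). Qed.

Lemma root_sound : sound_rules x root_rules.
Proof.
have ue1 : u * e1 = e1 * u.
  by rewrite -[LHS]mulr1 -su mulrA -(mulrA u) -se1 mulrA us mul1r.
rewrite /=; do !split=> //.
- by rewrite mulrA hC.
- by rewrite mulrA hC -mulrA se1 mulrA.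
- by rewrite mulrA hC -mulrA ue1 mulrA.
- by rewrite s_sqr addrC addKr.
Qed.

Lemma t_sound : sound_rules x t_rules.
Proof.
have cP := sound_rules_cat central_sound pbw_sound.
rewrite /=; do !split=> //; nc cP.
Qed.

Lemma anticomm_comm (a y : A) :
  a * (a * y - y * a) + (a * y - y * a) * a = a * a * y - y * (a * a).
Proof. by rewrite mulrBr mulrBl !mulrA addrA subrK. Qed.

(** If d satisfies the equation obtained by differentiating s^2 = 1 + t^2 along
    the commutator with y, then d is the commutator of s with y. *)
Lemma comm_s y d :
  s * d + d * s = t * (t * y - y * t) + (t * y - y * t) * t ->
  y * s = s * y - d.
Proof.
move=> sd; suff cd : s * y - y * s - d = 0 by rewrite -(subr0_eq cd) subKr.
apply: s_anti_inj; rewrite mulrBr mulrBl addrACA -opprD sd !anticomm_comm s_sqr.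
by rewrite mulrDl mulrDr mul1r mulr1 opprD addrACA subrr add0r subrr.
Qed.

Lemma s_sound : sound_rules x s_rules.
Proof.
have t_stage :
    sound_rules x (central_rules ++ root_rules ++ pbw_rules ++ t_rules).
  apply: sound_rules_cat central_sound _; apply: sound_rules_cat root_sound _.
  exact: sound_rules_cat pbw_sound t_sound.
have h1s : h1 * s = s * h1 + 2 * s - 2 * u.
  by rewrite (@comm_s _ (2 * u - 2 * s)) ?opprB ?addrA //; nc t_stage.
have h1u : h1 * u = u * h1 - 2 * u + 2 * u ^+ 3.
  have -> : h1 * u = u * (s * h1) * u by rewrite mulrA us mul1r.
  have -> : s * h1 = h1 * s - (2 * s - 2 * u) by rewrite h1s; nc t_stage.
  have -> : u * (h1 * s - (2 * s - 2 * u)) * u = u * h1 * (s * u)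
    - (2 * u * (s * u) - 2 * u ^+ 3) by nc t_stage.
  by rewrite su; nc t_stage.
have h2s : h2 * s = s * h2 - s + u.
  by rewrite (@comm_s _ (s - u)) ?opprB ?addrA 1?addrAC //; nc t_stage.
have e3s : e3 * s = s * e3.
  by rewrite (@comm_s _ 0) ?subr0 //; nc t_stage.
have f2s : f2 * s = s * f2.
  by rewrite (@comm_s _ 0) ?subr0 //; nc t_stage.
(* The commutators of t with f_1, e_2, f_3 are multiples of h_1, e_3, f_2, whose
   own rules for s are needed to check the closed formulas. *)
have stage : sound_rules x
  (central_rules ++ root_rules ++ pbw_rules ++ t_rules ++ [::
     Xh1 ** Xs ~> Xs * Xh1 + NNat 2 * Xs - NNat 2 * Xu;
     Xe3 ** Xs ~> Xs * Xe3;
     Xf2 ** Xs ~> Xs * Xf2]).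
  apply: sound_rules_cat central_sound _; apply: sound_rules_cat root_sound _.
  by apply: sound_rules_cat pbw_sound _; apply: sound_rules_cat t_sound _.
have f1s : f1 * s = s * f1 - (h * t * u * h1 + h * t * u ^+ 3).
  by apply: comm_s; nc stage.
have e2s : e2 * s = s * e2 - h * t * u * e3.
  by apply: comm_s; nc stage.
have f3s : f3 * s = s * f3 - (- (h * t * u * f2)).
  by apply: comm_s; nc stage.
rewrite /=; do !split => //.
- by rewrite f1s opprD addrA.
- by rewrite f3s opprK.
Qed.

Lemma deformed_sound : sound_rules x deformed_rules.
Proof.
apply: sound_rules_cat central_sound _; apply: sound_rules_cat root_sound _.
apply: sound_rules_cat pbw_sound _; apply: sound_rules_cat t_sound _.
exact: s_sound.
Qed.
End PBW.

(** * Evaluation of noncommutative polynomials *)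

Lemma rmorph_sbracket (A B : nzRingType) (g : {rmorphism A -> B})
    (O : set A) (x y : A) (bx b_y : bool) : (O x <-> bx) -> (O y <-> b_y) ->
  g (sbracket O x y) = g x * g y - (-1) ^+ (bx && b_y) * (g y * g x).
Proof.
move=> Ox Oy; rewrite /sbracket rmorphB !rmorphM rmorph_sign.
by rewrite (asbool_equiv_eq Ox) (asbool_equiv_eq Oy) !asboolb.
Qed.

Lemma rmorph_commutator (A B : nzRingType) (f : {rmorphism A -> B}) x y :
  f (x * y - y * x) = f x * f y - f y * f x.
Proof. by rewrite rmorphB !rmorphM. Qed.

Section FreeEval.
Context (K : fieldType) (I : choiceType) (par : I -> bool).
Context (B : algType K) (v : I -> B).
Local Notation F := {malg K[{fmonom I}]}.

Definition word_eval (w : {fmonom I}) : B := \prod_(i <- (w : seq I)) v i.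

Lemma word_eval_mmorphism : mmorphism word_eval.
Proof.
by split=> [w w'|]; rewrite /word_eval ?fmM ?big_cat // fm1 big_nil.
Qed.
HB.instance Definition _ :=
  monalg.isMultiplicative.Build {fmonom I} B word_eval word_eval_mmorphism.

Definition free_eval (x : F) : B := mmap (in_alg B) word_eval x.

Fact free_eval_zmod_morphism : zmod_morphism free_eval.
Proof. exact: raddfB. Qed.
HB.instance Definition _ :=
  GRing.isZmodMorphism.Build F B free_eval free_eval_zmod_morphism.

Fact free_eval_monoid_morphism : monoid_morphism free_eval.
Proof.
have comm (g : F) w w' : GRing.comm (in_alg B g@_w) (word_eval w').
  by rewrite /GRing.comm /= mulr_algl mulr_algr.
have [evM ev1] := commr_mmap_is_multiplicative comm.
by split.
Qed.
HB.instance Definition _ :=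
  GRing.isMonoidMorphism.Build F B free_eval free_eval_monoid_morphism.

Lemma free_evalZ c x : free_eval (c *: x) = c *: free_eval x.
Proof. by rewrite /free_eval mmapZ mulr_algl. Qed.

Lemma free_eval_gen i : free_eval (free_gen K i) = v i.
Proof.
by rewrite /free_eval mmapU /word_eval /= fmU big_seq1 scale1r mul1r.
Qed.

Lemma free_eval_commutator (i j : I)
    (x := free_gen K i : F) (y := free_gen K j : F) :
  free_eval (x * y - y * x) = v i * v j - v j * v i.
Proof. by rewrite (rmorph_commutator free_eval x y) /= !free_eval_gen. Qed.

Lemma free_eval_ideal (rel : set F) :
  (forall x, rel x -> free_eval x = 0) ->
  forall x, rel_ideal rel x -> free_eval x = 0.
Proof.
move=> rel0 x /(_ [set x | free_eval x = 0]) /=; apply; split=> //; split=> /=.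
- exact: rmorph0.
- by move=> y z /= y0 z0; rewrite rmorphD /= y0 z0 addr0.
- by move=> a y b /= y0; rewrite !rmorphM /= y0 mulr0 mul0r.
Qed.

(** The universal property of the presentation: an evaluation that kills the
    relations only depends on the class of a noncommutative polynomial. *)
Lemma free_eval_presented (rel : set F) :
  (forall x, rel x -> free_eval x = 0) -> forall x y,
  \pi_(presented rel) x = \pi_(presented rel) y -> free_eval x = free_eval y.
Proof.
move=> rel0 x y /pr_eqP /(free_eval_ideal rel0); rewrite rmorphB.
exact: subr0_eq.
Qed.

Lemma free_gen_part i b : free_part par b (free_gen K i) <-> par i = b.
Proof.
have wpar : word_parity par (fmu i) = par i.
  by rewrite /word_parity fmU /= addn0 oddb.
split=> [/(_ (fmu i))|ib w].
  by rewrite /free_gen mcoeffU eqxx oner_eq0 wpar => /(_ isT).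
by rewrite mcoeffU; case: (fmu i =P w) => [<-|_]; rewrite ?wpar ?eqxx.
Qed.

Lemma malg_gen_ind (P : F -> Prop) :
  (forall x y, P x -> P y -> P (x + y)) ->
  (forall x y, P x -> P y -> P (x * y)) ->
  (forall c x, P x -> P (c *: x)) -> P 1 -> (forall i, P (free_gen K i)) ->
  forall x, P x.
Proof.
move=> PD PM PZ P1 Pg x; rewrite (monalgE x).
have P0 : P 0 by rewrite -(scale0r 1); apply: PZ.
have Pw (s : seq I) : P << FMonom s >>.
  elim: s => [|i s IHs]; first by rewrite -fmoneE.
  have -> : << FMonom (i :: s) >> = free_gen K i * << FMonom s >> :> F;
    last exact: PM.
  rewrite malgM_def /free_gen fgmulUU mulr1 fmuE; congr << _ >>.
  by rewrite /mmul /= fmmulE.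
elim/big_rec: _ => // w y _ Py; apply: PD => //.
have -> : << x@_w *g w >> = x@_w *: << w >> :> F.
  by apply/malgP => w'; rewrite mcoeffZ [LHS]mcoeffU mcoeffU1 mulr_natr.
by apply: PZ; case: (w) => s.
Qed.

End FreeEval.

(** * Algebras satisfying the relations of sl(2|1) *)

Section Sl21Relations.
Variable R : realType.
Local Notation C := (complexes R).

(** The values v of the generators in an algebra satisfy the defining
    relations. The brackets are written out, with the sign that the parity of
    the generators prescribes, so that they make sense in an algebra without
    any grading. *)
Record sl21_system (B : algType C) (v : sl21_idx -> B)
    (h := fun i => v (inl (inl i))) (e := fun i => v (inl (inr i)))
    (f := fun i => v (inr i)) : Prop := Sl21System {
  sys_hh : forall i j, h i * h j = h j * h i;
  sys_he : forall i j, h i * e j - e j * h i = cartan R i j *: e j;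
  sys_hf : forall i j, h i * f j - f j * h i = - (cartan R i j *: f j);
  sys_ef : forall i j,
    e i * f j - (-1) ^+ ((i == 1) && (j == 1)) * (f j * e i)
      = (i == j)%:R *: h i;
  sys_ee : e 1 * e 1 = 0;
  sys_ff : f 1 * f 1 = 0;
  sys_eee : GRing.comm (e 0) (e 0 * e 1 - e 1 * e 0);
  sys_fff : GRing.comm (f 0) (f 0 * f 1 - f 1 * f 0)
}.

Lemma sl21_systemP (B : algType C) (v : sl21_idx -> B) :
  (forall x, sl21_rel x -> free_eval v x = 0) <-> sl21_system v.
Proof.
have ev := free_eval_gen v; have odd g := free_gen_part C sl21_odd g true.
have double0 (y : B) : y - (-1) ^+ true * y = 0 <-> y = 0.
  rewrite mulN1r opprK -mulr2n -scaler_nat.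
  split=> [/eqP|->]; last exact: scaler0.
  by rewrite scaler_eq0 pnatr_eq0 /= => /eqP.
have brE g g' : free_eval v (free_br (free_gen C g) (free_gen C g')) =
    v g * v g' - (-1) ^+ (sl21_odd g && sl21_odd g') * (v g' * v g).
  by rewrite (rmorph_sbracket _ (odd g) (odd g')) /= !ev.
have brrE g g' : sl21_odd g = false ->
    free_eval v
      (free_br (free_gen C g) (free_br (free_gen C g) (free_gen C g'))) =
    v g * (v g * v g' - v g' * v g) - (v g * v g' - v g' * v g) * v g.
  move=> g0; rewrite (rmorph_sbracket _ (odd g) (rwP (asboolP _))) /= g0 brE g0.
  by rewrite !mul1r ev.
split=> [rel0|[hh he hf ef ee ff eee fff] _ []].
- split.
  + move=> i j; have := rel0 _ (rel_hh R i j).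
    by rewrite brE /= mul1r => /subr0_eq.
  + move=> i j; have := rel0 _ (rel_he R i j).
    by rewrite rmorphB /= brE free_evalZ ev /= mul1r => /subr0_eq.
  + move=> i j; have := rel0 _ (rel_hf R i j).
    rewrite rmorphD /= brE free_evalZ ev /= mul1r => /eqP.
    by rewrite addr_eq0 => /eqP.
  + move=> i j; have := rel0 _ (rel_ef R i j).
    by rewrite rmorphB /= brE free_evalZ ev /= => /subr0_eq.
  + by have := rel0 _ (rel_ee R); rewrite brE => /double0.
  + by have := rel0 _ (rel_ff R); rewrite brE => /double0.
  + by have := rel0 _ (rel_eee R); rewrite brrE // => /subr0_eq.
  + by have := rel0 _ (rel_fff R); rewrite brrE // => /subr0_eq.
- by move=> i j; rewrite brE /= mul1r hh subrr.
- by move=> i j; rewrite rmorphB /= brE free_evalZ ev /= mul1r he subrr.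
- by move=> i j; rewrite rmorphD /= brE free_evalZ ev /= mul1r hf addNr.
- by move=> i j; rewrite rmorphB /= brE free_evalZ ev /= ef subrr.
- by rewrite brE; apply/double0.
- by rewrite brE; apply/double0.
- by rewrite brrE // eee subrr.
- by rewrite brrE // fff subrr.
Qed.

Lemma sl21_system_map (B B' : algType C) (f : {rmorphism B -> B'}) v :
  (forall c x, f (c *: x) = c *: f x) -> sl21_system v -> sl21_system (f \o v).
Proof.
move=> fZ /sl21_systemP sysv; apply/sl21_systemP => x /sysv x0.
rewrite -(rmorph0 f) -x0; elim/malg_gen_ind: x {x0} =>
  [x y xE yE|x y xE yE|c x xE||i].
- by rewrite rmorphD /= xE yE -rmorphD; congr (f _); rewrite -rmorphD.
- by rewrite rmorphM /= xE yE -rmorphM; congr (f _); rewrite -rmorphM.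
- by rewrite !free_evalZ fZ xE.
- by rewrite !rmorph1.
- by rewrite !free_eval_gen.
Qed.

Definition Usl21_gen (g : sl21_idx) : Usl21 R :=
  \pi_(presented (@sl21_rel R)) (free_gen C g).

Lemma Usl21_evalE x :
  free_eval Usl21_gen x = \pi_(presented (@sl21_rel R)) x.
Proof.
elim/malg_gen_ind: x => [x y xE yE|x y xE yE|c x xE||i].
- by rewrite rmorphD /= xE yE; exact: pr_addE.
- by rewrite rmorphM /= xE yE; exact: pr_mulE.
- by rewrite free_evalZ xE; exact: pr_scaleE.
- exact: rmorph1.
- exact: free_eval_gen.
Qed.

Lemma Usl21_system : sl21_system Usl21_gen.
Proof.
apply/sl21_systemP => x relx; rewrite Usl21_evalE.
have -> : 0 = \pi_(presented (@sl21_rel R)) 0 :> Usl21 R by [].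
by apply/pr_eqP; rewrite subr0 => J [_]; apply.
Qed.

Lemma Usl21_ind (P : Usl21 R -> Prop) :
  (forall x y, P x -> P y -> P (x + y)) ->
  (forall x y, P x -> P y -> P (x * y)) ->
  (forall c x, P x -> P (c *: x)) -> P 1 -> (forall g, P (Usl21_gen g)) ->
  forall x, P x.
Proof.
move=> PD PM PZ P1 Pg; elim/quotW.
elim/malg_gen_ind => [x y Px Py|x y Px Py|c x Px||g].
- exact: (eq_ind _ P (PD _ _ Px Py) _ (pr_addE _ _ _)).
- exact: (eq_ind _ P (PM _ _ Px Py) _ (pr_mulE _ _ _)).
- exact: (eq_ind _ P (PZ c _ Px) _ (pr_scaleE _ _ _)).
- exact: P1.
- exact: Pg.
Qed.

Lemma Usl21_lift (B : algType C) (v : sl21_idx -> B) : sl21_system v ->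
  forall x y, free_eval Usl21_gen x = free_eval Usl21_gen y ->
  free_eval v x = free_eval v y.
Proof.
move=> /sl21_systemP sysv x y; rewrite !Usl21_evalE.
exact: free_eval_presented.
Qed.

End Sl21Relations.

Section Sl21Rules.
Variable R : realType.
Local Notation C := (complexes R).
Variables (B : algType C) (v : sl21_idx -> B).
Hypothesis sysv : sl21_system v.
Local Notation vh i := (v (inl (inl i))).
Local Notation ve i := (v (inl (inr i))).
Local Notation vf i := (v (inr i)).

Lemma chevalley_sound h s u : sound_rules
  (nth 0 (letters h s u (vh 0) (vh 1) (ve 0) (ve 1) (vf 0) (vf 1)))
  chevalley_rules.
Proof.
have [hh he hf ef ee ff _ _] := sysv.
have swap (x y z : B) : x * y - y * x = z -> y * x = x * y - z.
  by move=> <-; rewrite subKr.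
have Z2 (x : B) : (2 : C) *: x = 2 * x by rewrite scaler_nat mulr_natl.
rewrite /=; do !split => //.
- by rewrite (swap _ _ _ (he 0 0)) Z2.
- by rewrite (swap _ _ _ (he 1 0)) scaleN1r opprK.
- by rewrite (swap _ _ _ (he 0 1)) scaleN1r opprK.
- by rewrite (swap _ _ _ (he 1 1)) scale0r subr0.
- by rewrite (swap _ _ _ (hf 0 0)) opprK Z2.
- by rewrite (swap _ _ _ (hf 1 0)) opprK scaleN1r.
- by rewrite (swap _ _ _ (hf 0 1)) opprK scaleN1r.
- by rewrite (swap _ _ _ (hf 1 1)) opprK scale0r addr0.
- by have := ef 0 0; rewrite /= expr0 mul1r scale1r => /swap.
- by have := ef 1 0; rewrite /= expr0 mul1r scale0r => /swap ->; rewrite subr0.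
- by have := ef 0 1; rewrite /= expr0 mul1r scale0r => /swap ->; rewrite subr0.
- have := ef 1 1; rewrite /= expr1 mulN1r opprK scale1r => <-.
  by rewrite addrC addKr.
Qed.

(** This is how e_1 is recovered from the deformed generators. *)
Lemma sl21_anticomm_f2_e3 (e1 := ve 0) (e2 := ve 1) (f2 := vf 1) :
  f2 * (e1 * e2 - e2 * e1) + (e1 * e2 - e2 * e1) * f2 = e1.
Proof. have P := chevalley_sound 0 0 0; rewrite /e1 /e2 /f2; nc P. Qed.

End Sl21Rules.

(** * Formal power series in h *)

Section FpsTheory.
Context (K : fieldType) (A : algType K).
Implicit Types (x y z : fps A) (a b : A).

Lemma fcoefD x y n : fcoef (x + y) n = fcoef x n + fcoef y n.
Proof. by []. Qed.

Lemma fcoefN x n : fcoef (- x) n = - fcoef x n.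
Proof. by []. Qed.

Lemma fcoefZ (c : K) x n : fcoef (c *: x) n = c *: fcoef x n.
Proof. by []. Qed.

Lemma fps_const_zmod_morphism : zmod_morphism (@fps_const K A).
Proof. by move=> a b; apply: fpsP => n; rewrite /= mulrnBl. Qed.

Lemma fcoef_constM a x n : fcoef (fps_const a * x) n = a * fcoef x n.
Proof.
rewrite fps_mulE big_ord_recl subn0 big1 ?addr0 //= => i _.
by rewrite mulr0n mul0r.
Qed.

Lemma fcoef_Mconst a x n : fcoef (x * fps_const a) n = fcoef x n * a.
Proof.
rewrite fps_mul_rev big_ord_recl subn0 big1 ?addr0 //= => i _.
by rewrite mulr0n mulr0.
Qed.

Lemma fps_const_monoid_morphism : monoid_morphism (@fps_const K A).
Proof.
by split=> [|a b]; apply: fpsP => n; rewrite ?fcoef_constM //= mulrnAr.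
Qed.

HB.instance Definition _ := GRing.isZmodMorphism.Build A (fps A)
  (@fps_const K A) fps_const_zmod_morphism.
HB.instance Definition _ := GRing.isMonoidMorphism.Build A (fps A)
  (@fps_const K A) fps_const_monoid_morphism.

Lemma fps_constZ (c : K) a : fps_const (c *: a) = c *: fps_const a.
Proof. by apply: fpsP => n; rewrite /= scalerMnr. Qed.

Lemma at_h0_zmod_morphism : zmod_morphism (@at_h0 K A).
Proof. by []. Qed.

Lemma at_h0_monoid_morphism : monoid_morphism (@at_h0 K A).
Proof. by split=> [|x y]; rewrite /at_h0 //= big_ord1. Qed.

HB.instance Definition _ := GRing.isZmodMorphism.Build (fps A) A (@at_h0 K A)
  at_h0_zmod_morphism.
HB.instance Definition _ := GRing.isMonoidMorphism.Build (fps A) A (@at_h0 K A)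
  at_h0_monoid_morphism.

Lemma at_h0_const a : at_h0 (fps_const a) = a.
Proof. by []. Qed.

(** The scalar series on the left is h^k. *)
Lemma fcoef_shift k x n :
  fcoef (fps_scalar (fun i => (i == k)%:R) * x) n =
  if (k <= n)%N then fcoef x (n - k) else 0.
Proof.
rewrite fps_mulE; case: leqP => [le_kn|lt_nk].
  rewrite (bigD1 (Ordinal (le_kn : (k < n.+1)%N))) //= eqxx scale1r mul1r.
  rewrite big1 ?addr0 // => i /negPf; rewrite -val_eqE /= => ->.
  by rewrite scale0r mul0r.
rewrite big1 // => i _ /=; case: eqP => [ik|_]; last by rewrite scale0r mul0r.
by move: (ltn_ord i); rewrite ik ltnS leqNgt lt_nk.
Qed.

Lemma shiftP k x : (forall i, (i < k)%N -> fcoef x i = 0) ->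
  exists y, x = fps_scalar (fun i => (i == k)%:R) * y.
Proof.
move=> x0; exists (Fps (fun n => fcoef x (k + n))); apply: fpsP => n.
by rewrite fcoef_shift; case: leqP => [le_kn|/x0 //]; rewrite /= subnKC.
Qed.

Lemma hbarE : hbar = fps_scalar (fun i => (i == 1%N)%:R) :> fps A.
Proof. by apply: fpsP => n /=; rewrite scaler_nat. Qed.

Lemma fcoef_hM x n : fcoef (hbar * x) n = if n is m.+1 then fcoef x m else 0.
Proof. by rewrite hbarE fcoef_shift; case: n => [|n] //=; rewrite subn1. Qed.

Lemma hbar_central x : x * hbar = hbar * x.
Proof.
apply: fpsP => n; rewrite fcoef_hM fps_mul_rev.
case: n => [|n]; first by rewrite big_ord1 mulr0.
rewrite (bigD1 (Ordinal (isT : (1 < n.+2)%N))) //= mulr1 subn1.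
rewrite big1 ?addr0 // => -[[|[|i]] //= _ _]; by rewrite mulr0.
Qed.

Lemma hbar_inj x y : hbar * x = hbar * y -> x = y.
Proof.
move=> xy; apply: fpsP => n.
by have /(congr1 (fun z : fps A => fcoef z n.+1)) := xy; rewrite !fcoef_hM.
Qed.

(** In degree n the equation reads 2 y_n = 0 once the lower coefficients of y
    are known to vanish. *)
Lemma fps_anticomm_inj s y : 2 != 0 :> K -> fcoef s 0 = 1 ->
  s * y + y * s = 0 -> y = 0.
Proof.
move=> nz2 s0 sy0; apply: fpsP => n; have [m] := ubnP n.
elim: m n => // m IHm n; rewrite ltnS => le_nm.
have lt_m (i : 'I_n) : (n - lift ord0 i < m)%N.
  apply: leq_trans le_nm; rewrite lift0 subnS prednK ?leq_subr //.
  by rewrite subn_gt0.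
have /(congr1 (fun z : fps A => fcoef z n)) := sy0.
rewrite fcoefD [fcoef (y * s) n]fps_mul_rev.
rewrite fps_mulE !big_ord_recl subn0 s0 mul1r mulr1 !big1 ?addr0; last first.
- by move=> i _; rewrite IHm ?mulr0.
- by move=> i _; rewrite IHm ?mul0r.
rewrite -mulr2n -scaler_nat => /eqP; rewrite scaler_eq0 (negPf nz2) /=.
by move/eqP.
Qed.

(** A square root has its coefficients in every subalgebra that contains those
    of x. This gives both the parity of s and its commutation with e_1. *)
Lemma fps_sqrt_closed (S : set A) x :
  S 1 -> (forall a b, S a -> S b -> S (a - b)) ->
  (forall a b, S a -> S b -> S (a * b)) ->
  (forall (c : K) a, S a -> S (c *: a)) -> (forall n, S (fcoef x n)) ->
  forall n, S (fcoef (fps_sqrt x) n).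
Proof.
move=> S1 SB SM SZ Sx n; have [m] := ubnP n.
have S0 : S 0 by rewrite -(subrr 1); exact: SB.
have SN a : S a -> S (- a) by rewrite -[- a]add0r; exact: SB.
elim: m n => // m IHm [_|n lt_nm]; first exact: S1.
rewrite fps_sqrtS; apply/SZ/SB => //; rewrite big_seq.
elim/big_rec: _ => // i y; rewrite mem_index_iota => /andP[i_gt0 lt_in] Sy.
rewrite -[y]opprK; apply: SB; last exact: SN.
apply: SM; apply: IHm; first exact: leq_trans lt_in lt_nm.
case: i i_gt0 {lt_in} => // i _; rewrite subSS.
exact: leq_ltn_trans (leq_subr _ _) (lt_nm : (n < m)%N).
Qed.

(** v is the sum of the (-1)^m h^(2m) a^(2m). *)
Lemma geometric_inverse a
    (v := Fps (fun n => (~~ odd n)%:R *: ((-1) ^+ n./2 *: a ^+ n)) : fps A)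
    (w := 1 + hbar ^+ 2 * fps_const a ^+ 2) :
  v * w = 1 /\ w * v = 1.
Proof.
have fx2 x n : fcoef (hbar ^+ 2 * x) n = if n is m.+2 then fcoef x m else 0.
  by rewrite -mulrA !fcoef_hM; case: n => // -[|n]; rewrite ?fcoef_hM.
have tail n : a ^+ 2 * fcoef v n = - fcoef v n.+2.
  by rewrite /= negbK -!scalerAr -exprD exprS mulN1r scaleNr scalerN opprK.
have va2 n : fcoef v n * a ^+ 2 = a ^+ 2 * fcoef v n.
  by rewrite /= -!scalerAr -!scalerAl -!exprD addnC.
have sums x : x = hbar ^+ 2 * (fps_const (a ^+ 2) * v) -> v + x = 1.
  move=> ->; apply: fpsP => n; rewrite fcoefD fx2; case: n => [|[|n]].
  - by rewrite /= addr0 expr0 !scale1r.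
  - by rewrite /= addr0 scale0r.
  - by rewrite fcoef_constM tail subrr.
split; rewrite /w -rmorphXn; last by rewrite mulrDl mul1r -mulrA; exact: sums.
rewrite mulrDr mulr1 mulrA; apply: sums.
rewrite expr2 !mulrA !hbar_central -!mulrA; congr (_ * (_ * _)).
by apply: fpsP => n; rewrite fcoef_Mconst fcoef_constM.
Qed.

Lemma two_hbar_inj x y :
  2 != 0 :> K -> 2 * hbar * x = 2 * hbar * y -> x = y.
Proof.
move=> nz2; rewrite -!mulrA !mulr_natl -!scaler_nat => /(scalerI nz2).
exact: hbar_inj.
Qed.

Lemma at_h0_mul0 x y : at_h0 x = 0 -> at_h0 (x * y) = 0.
Proof. by move=> x0; rewrite rmorphM /= x0 mul0r. Qed.

Lemma at_h0_h2 : at_h0 (hbar ^+ 2 : fps A) = 0.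
Proof. exact: at_h0_mul0. Qed.

Lemma at_h0_perturbB c x y : at_h0 y = 0 -> at_h0 (x - c *: y) = at_h0 x.
Proof. by rewrite /at_h0 fcoefD fcoefN fcoefZ => ->; rewrite scaler0 subr0. Qed.

Lemma at_h0_perturbD c x y : at_h0 y = 0 -> at_h0 (x + c *: y) = at_h0 x.
Proof. by rewrite /at_h0 fcoefD fcoefZ => ->; rewrite scaler0 addr0. Qed.

Lemma at_h0_sqrt x y : at_h0 (fps_sqrt x * y) = at_h0 y.
Proof. by rewrite rmorphM /= mul1r. Qed.

Lemma at_h0_exp x y : at_h0 (hbar * x + fps_sqrt y) = 1.
Proof. by rewrite /at_h0 fcoefD fcoef_hM add0r. Qed.

Lemma at_h0_expN x y : at_h0 (- (hbar * x) + fps_sqrt y) = 1.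
Proof. by rewrite /at_h0 fcoefD fcoefN fcoef_hM oppr0 add0r. Qed.

Lemma fcoef_add_shift1 (h1 := fps_scalar (fun i => (i == 1%N)%:R)) x y z n :
  (forall i, (i < n)%N -> fcoef y i = fcoef z i) ->
  forall i, (i < n.+1)%N -> fcoef (x + h1 * y) i = fcoef (x + h1 * z) i.
Proof.
move=> yz [|i] lt_in; rewrite !fcoefD !fcoef_shift //=.
by rewrite subn1 yz.
Qed.

End FpsTheory.

Section SqrtSeries.
Context (K : fieldType) (A : algType K) (a : A).
Hypothesis nz2 : 2 != 0 :> K.
Let x := 1 + hbar ^+ 2 * fps_const a ^+ 2 : fps A.
Let s := fps_sqrt x.

Lemma sqrt_const1 : fcoef x 0 = 1.
Proof. by rewrite /x fcoefD -mulrA fcoef_hM addr0. Qed.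

Lemma sqrt_sqr : s * s = 1 + (hbar * fps_const a) * (hbar * fps_const a).
Proof.
rewrite (fps_sqrtP nz2 sqrt_const1).2; congr (1 + _).
by rewrite -[RHS]mulrA (mulrA (fps_const a)) hbar_central !mulrA.
Qed.

Lemma sqrt_comm : s * fps_const a = fps_const a * s.
Proof.
apply: fpsP => n; rewrite fcoef_Mconst fcoef_constM; apply: commr_sym.
apply: (@fps_sqrt_closed _ _ (GRing.comm a)) => [|b c|b c|c b|{}n].
- exact: commr1.
- exact: commrB.
- exact: commrM.
- by rewrite /GRing.comm -scalerAr -scalerAl => ->.
- have commh y : (forall m, GRing.comm a (fcoef y m)) ->
      forall m, GRing.comm a (fcoef (hbar * y) m).
    by move=> ya [|m]; rewrite fcoef_hM //; exact: commr0.
  rewrite /x fcoefD -mulrA -rmorphXn; apply: commrD; first exact: commr_nat.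
  apply: (commh _) => m; apply: (commh _) => {}m.
  exact/commrMn/commrX/commr_refl.
Qed.

(** u = s v, where v is the geometric series for 1 / s^2. *)
Lemma sqrt_inverse : exists u, s * u = 1 /\ u * s = 1.
Proof.
have [vx xv] := geometric_inverse a; set v := Fps _ in vx xv.
have ss : s * s = x := (fps_sqrtP nz2 sqrt_const1).2.
have vs : v * s = s * v.
  by rewrite -[LHS]mulr1 -xv -/x -{1}ss !mulrA -(mulrA v) ss -/x vx mul1r.
by exists (s * v); rewrite mulrA ss xv -mulrA vs mulrA ss xv.
Qed.

End SqrtSeries.

Section DeformedRules.
Variable R : realType.
Local Notation C := (complexes R).
Variables (B : algType C) (v : sl21_idx -> B).
Hypothesis sysv : sl21_system v.
Local Notation "x %:h" := (fps_const x : fps B) (at level 2).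

Lemma series_deformed_sound : exists u : fps B, sound_rules
  (nth 0 (letters hbar
    (fps_sqrt (1 + hbar ^+ 2 * (v (inl (inr 0)))%:h ^+ 2)) u
    (v (inl (inl 0)))%:h (v (inl (inl 1)))%:h (v (inl (inr 0)))%:h
    (v (inl (inr 1)))%:h (v (inr 0))%:h (v (inr 1))%:h)) deformed_rules.
Proof.
have nz2 : 2 != 0 :> C by rewrite pnatr_eq0.
have [u [su us]] := sqrt_inverse (v (inl (inr 0))) nz2; exists u.
have sysh := sl21_system_map (@fps_constZ C B) sysv.
have [_ _ _ _ _ _ eee fff] := sysh.
apply: deformed_sound => //.
- exact: (chevalley_sound sysh).
- by apply/commr_sym; rewrite -opprB; apply/commr_sym/commrN.
- exact: hbar_central.
- exact: sqrt_sqr.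
- exact: sqrt_comm.
- by move=> y; exact: fps_anticomm_inj.
Qed.
End DeformedRules.

(** * The parity grading of U(sl(2|1)) *)

Lemma mulr_split (A : pzSemiRingType) (x0 x1 y0 y1 : A) :
  (x0 + x1) * (y0 + y1) = (x0 * y0 + x1 * y1) + (x0 * y1 + x1 * y0).
Proof. by rewrite mulrDl !mulrDr [x1 * y0 + _]addrC addrACA. Qed.

Section Grading.
Variable R : realType.
Local Notation C := (complexes R).
Local Notation U := (Usl21 R).
Local Notation F := {malg C[{fmonom sl21_idx}]}.
Local Notation g := (@Usl21_gen R).

Implicit Types x y : U.

Section Twist.
Variables (B : algType C) (v : sl21_idx -> B).

(** The relations being homogeneous, they are preserved by the change of sign of
    the odd generators. *)
Definition parity_twist (i : sl21_idx) : B := (-1) ^+ sl21_odd i *: v i.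

Lemma parity_twist_system : sl21_system v -> sl21_system parity_twist.
Proof.
move=> [hh he hf ef ee ff eee fff].
have ZM (a b : C) (x y : B) : (a *: x) * (b *: y) = (a * b) *: (x * y).
  by rewrite -scalerAl -scalerAr scalerA.
split=> [i j|i j|i j|i j||||]; rewrite /parity_twist /= ?scale1r.
- exact: hh.
- by rewrite -scalerAr -scalerAl -scalerBr he !scalerA mulrC.
- by rewrite -scalerAr -scalerAl -scalerBr hf scalerN !scalerA mulrC.
- rewrite !ZM -scalerAr [_ ^+ (j == 1) * _]mulrC -scalerBr ef -signr_addb.
  rewrite scalerA.
  by case: (i =P j) => [->|_]; rewrite ?addbb ?mul1r // mulr0 scale0r.
- by rewrite ZM ee scaler0.
- by rewrite ZM ff scaler0.
- rewrite /GRing.comm -!scalerAr -!scalerAl -!scalerBr -scalerAr -scalerAl.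
  by rewrite eee.
- rewrite /GRing.comm -!scalerAr -!scalerAl -!scalerBr -scalerAr -scalerAl.
  by rewrite fff.
Qed.

Lemma word_eval_twist (w : {fmonom sl21_idx}) :
  word_eval parity_twist w = (-1) ^+ word_parity sl21_odd w *: word_eval v w.
Proof.
rewrite /word_eval /word_parity; elim: (w : seq _) => [|i s IHs] /=.
  by rewrite !big_nil scale1r.
rewrite !big_cons IHs -scalerAr -scalerAl scalerA oddD signr_addb mulrC.
by rewrite oddb.
Qed.

Lemma free_eval_twist b (x : F) : free_part sl21_odd b x ->
  free_eval parity_twist x = (-1) ^+ b *: free_eval v x.
Proof.
move=> xb; rewrite /free_eval !mmapE scaler_sumr big_seq [RHS]big_seq.
apply: eq_bigr => w; rewrite -mcoeff_neq0 => /xb <-.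
by rewrite word_eval_twist -scalerAr.
Qed.
End Twist.

Lemma Usl21_partP b x : Usl21_part b x <->
  exists2 y : F, free_part sl21_odd b y & free_eval g y = x.
Proof.
split=> -[y yb yx]; exists y => //.
- by rewrite Usl21_evalE.
- by rewrite -Usl21_evalE.
Qed.

(** The parity automorphism fixes an even element and negates an odd one. *)
Lemma Usl21_part_disjoint x : Usl21_part false x -> Usl21_part true x -> x = 0.
Proof.
move=> /Usl21_partP [y y0 yx] /Usl21_partP [z z1 zx].
have : free_eval g y = free_eval g z by rewrite yx.
move=> /(Usl21_lift (parity_twist_system (Usl21_system R))).
rewrite (free_eval_twist _ y0) (free_eval_twist _ z1) yx zx.
rewrite scale1r scaleN1r => /eqP.
rewrite -addr_eq0 -mulr2n -scaler_nat scaler_eq0 pnatr_eq0 /=.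
by move/eqP.
Qed.

Lemma Usl21_partD b x y :
  Usl21_part b x -> Usl21_part b y -> Usl21_part b (x + y).
Proof.
move=> /Usl21_partP [x' xb <-] /Usl21_partP [y' yb <-]; apply/Usl21_partP.
exists (x' + y'); last exact: rmorphD.
move=> w; rewrite mcoeffD; have [/eqP ->|/xb //] := boolP (x'@_w == 0).
by rewrite add0r => /yb.
Qed.

Lemma Usl21_partZ b c x : Usl21_part b x -> Usl21_part b (c *: x).
Proof.
move=> /Usl21_partP [x' xb <-]; apply/Usl21_partP; exists (c *: x').
  by move=> w; rewrite mcoeffZ mulf_eq0 negb_or => /andP[_ /xb].
exact: free_evalZ.
Qed.

Lemma Usl21_part0 b : Usl21_part b (0 : U).
Proof.
apply/Usl21_partP; exists 0; last exact: rmorph0.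
by move=> w; rewrite mcoeff0 eqxx.
Qed.

Lemma Usl21_part1 : Usl21_part false (1 : U).
Proof.
apply/Usl21_partP; exists 1; last exact: rmorph1.
move=> w; rewrite mcoeff1.
case: (w =P mone) => [-> _|_]; last by rewrite eqxx.
by rewrite /word_parity fm1.
Qed.

Lemma Usl21_partN b x : Usl21_part b x -> Usl21_part b (- x).
Proof. by rewrite -scaleN1r; exact: Usl21_partZ. Qed.

Lemma Usl21_partB b x y :
  Usl21_part b x -> Usl21_part b y -> Usl21_part b (x - y).
Proof. by move=> xb /Usl21_partN; exact: Usl21_partD. Qed.

Lemma Usl21_partM a b x y :
  Usl21_part a x -> Usl21_part b y -> Usl21_part (a (+) b) (x * y).
Proof.
move=> /Usl21_partP [x' xa <-] /Usl21_partP [y' yb <-]; apply/Usl21_partP.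
exists (x' * y'); last exact: rmorphM.
move=> w; rewrite mcoeff_neq0 => /msuppM_le [w1 [w2]].
rewrite -!mcoeff_neq0 => -[/xa <- /yb <- ->].
by rewrite /word_parity fmM count_cat oddD.
Qed.

Lemma Usl21_part_gen i : Usl21_part (sl21_odd i) (g i).
Proof.
apply/Usl21_partP; exists (free_gen C i); last exact: free_eval_gen.
exact/free_gen_part.
Qed.

Lemma Usl21_part_decomp x : exists p : U * U,
  [/\ Usl21_part false p.1, Usl21_part true p.2 & x = p.1 + p.2].
Proof.
elim/Usl21_ind: x => [
  x y [[x0 x1] [/= x0P x1P ->]] [[y0 y1] [/= y0P y1P ->]]|
  x y [[x0 x1] [/= x0P x1P ->]] [[y0 y1] [/= y0P y1P ->]]|
  c x [[x0 x1] [/= x0P x1P ->]]||i].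
- exists (x0 + y0, x1 + y1) => /=.
  by split; [exact: Usl21_partD|exact: Usl21_partD|rewrite addrACA].
- exists (x0 * y0 + x1 * y1, x0 * y1 + x1 * y0) => /=; split.
  + exact: Usl21_partD (Usl21_partM x0P y0P) (Usl21_partM x1P y1P).
  + exact: Usl21_partD (Usl21_partM x0P y1P) (Usl21_partM x1P y0P).
  + exact: mulr_split.
- exists (c *: x0, c *: x1); split; rewrite ?scalerDr //; exact: Usl21_partZ.
- exists (1, 0); split; rewrite ?addr0 //; first exact: Usl21_part1.
  exact: Usl21_part0.
- have := Usl21_part_gen i; case: (sl21_odd i) => gi.
  + by exists (0, g i); split; rewrite ?add0r //; exact: Usl21_part0.
  + by exists (g i, 0); split; rewrite ?addr0 //; exact: Usl21_part0.
Qed.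

End Grading.

Section DefiningRepresentation.
Variable R : realType.
Local Notation C := (complexes R).
Local Notation E i j := (delta_mx (inord i) (inord j) : 'M[C]_3).

(** The defining representation on C^(2|1): e_1, e_2, f_1, f_2 act as the matrix
    units E_12, E_23, E_21, E_32, with indices counted from 0 below. *)
Definition sl21_rep (i : sl21_idx) : 'M[C]_3 :=
  match i with
  | inl (inl i) => if i == 0 then E 0 0 - E 1 1 else E 1 1 + E 2 2
  | inl (inr i) => if i == 0 then E 0 1 else E 1 2
  | inr i => if i == 0 then E 1 0 else E 2 1
  end.

(** Here the letter 3 i + j stands for the matrix unit E_ij. *)
Definition unit_rules : seq (nat * nat * ncexpr) :=
  [seq a ** b ~>
    (if a %% 3 == b %/ 3 then NVar (3 * (a %/ 3) + b %% 3) else NNat 0)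
  | a <- iota 0 9, b <- iota 0 9]%N.

Lemma matrix_unit_mul (i j k l : nat) :
  (i < 3)%N -> (j < 3)%N -> (k < 3)%N -> (l < 3)%N ->
  E i j * E k l = E i l *+ (j == k).
Proof.
move=> i3 j3 k3 l3; rewrite [LHS]mul_delta_mx_cond; congr (_ *+ _).
by rewrite -val_eqE /= !inordK.
Qed.

Lemma unit_sound : sound_rules (nth 0 [:: E 0 0; E 0 1; E 0 2; E 1 0; E 1 1;
  E 1 2; E 2 0; E 2 1; E 2 2]) unit_rules.
Proof.
rewrite /=; repeat (split; first by rewrite matrix_unit_mul).
exact: I.
Qed.

Lemma sl21_rep_system : sl21_system sl21_rep.
Proof.
have I2 (i : 'I_2) : i = 0 \/ i = 1.
  by case: i => -[|[|//]] ?; [left|right]; apply: val_inj.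
split=> [i j|i j|i j|i j||||]; rewrite /cartan ?/GRing.comm.
1-4: case: (I2 i) => ->; case: (I2 j) => ->.
all: rewrite /= ?(scaleN1r, scale0r, scale1r, scaler_nat, mulr2n, mulr1n).
all: rewrite ?mulr0n.
all: nc unit_sound.
Qed.

Lemma Usl21_eval_neq0 (x : {malg C[{fmonom sl21_idx}]}) (i j : 'I_3) :
  free_eval sl21_rep x i j = 1 -> free_eval (@Usl21_gen R) x != 0.
Proof.
move=> xij; apply/eqP => x0; have /eqP := xij; rewrite eq_sym.
have -> : free_eval sl21_rep x = free_eval sl21_rep 0.
  by apply: (Usl21_lift sl21_rep_system); rewrite x0 rmorph0.
by rewrite rmorph0 mxE oner_eq0.
Qed.

Lemma Usl21_gens_neq0 :
  [/\ h_1 R != 0, h_2 R != 0, h_3 R != 0 & f_1 R != 0] /\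
  [/\ e_2 R != 0, f_2 R != 0, e_3 R != 0 & f_3 R != 0].
Proof.
have gE (i : sl21_idx) :
    Usl21_gen R i = free_eval (@Usl21_gen R) (free_gen C i).
  by rewrite free_eval_gen.
split; split.
- rewrite [h_1 R]gE; apply: (@Usl21_eval_neq0 _ (inord 0) (inord 0)).
  by rewrite free_eval_gen /= !mxE -!val_eqE /= !inordK //= subr0.
- rewrite [h_2 R]gE; apply: (@Usl21_eval_neq0 _ (inord 1) (inord 1)).
  by rewrite free_eval_gen /= !mxE -!val_eqE /= !inordK //= addr0.
- rewrite /h_3 [h_1 R]gE [h_2 R]gE -rmorphD.
  apply: (@Usl21_eval_neq0 _ (inord 0) (inord 0)).
  rewrite rmorphD /= !free_eval_gen /= !mxE -!val_eqE /= !inordK //=.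
  by rewrite !addr0 subr0.
- rewrite [f_1 R]gE; apply: (@Usl21_eval_neq0 _ (inord 1) (inord 0)).
  by rewrite free_eval_gen /= mxE -!val_eqE /= !inordK.
- rewrite [e_2 R]gE; apply: (@Usl21_eval_neq0 _ (inord 1) (inord 2)).
  by rewrite free_eval_gen /= mxE -!val_eqE /= !inordK.
- rewrite [f_2 R]gE; apply: (@Usl21_eval_neq0 _ (inord 2) (inord 1)).
  by rewrite free_eval_gen /= mxE -!val_eqE /= !inordK.
- have <- : _ = e_3 R := free_eval_commutator (@Usl21_gen R)
      (inl (inr 0)) (inl (inr 1)).
  apply: (@Usl21_eval_neq0 _ (inord 0) (inord 2)).
  rewrite free_eval_commutator /=.
  have -> : E 0 1 * E 1 2 - E 1 2 * E 0 1 = E 0 2 by nc unit_sound.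
  by rewrite mxE -!val_eqE /= !inordK.
- have <- : _ = f_3 R := free_eval_commutator (@Usl21_gen R)
      (inr 1) (inr 0).
  apply: (@Usl21_eval_neq0 _ (inord 2) (inord 0)).
  rewrite free_eval_commutator /=.
  have -> : E 2 1 * E 1 0 - E 1 0 * E 2 1 = E 2 0 by nc unit_sound.
  by rewrite mxE -!val_eqE /= !inordK.
Qed.
End DefiningRepresentation.

(** * Gradings of U(sl(2|1))[[h]] *)

Section UhGrading.
Variable R : realType.
Local Notation U := (Usl21 R).
Local Notation A := (Uh R).
Implicit Types x y : A.

Lemma Uh_partD b x y : Uh_part b x -> Uh_part b y -> Uh_part b (x + y).
Proof. by move=> xb yb n; apply: Usl21_partD. Qed.

Lemma Uh_partN b x : Uh_part b x -> Uh_part b (- x).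
Proof. by move=> xb n; apply: Usl21_partN. Qed.

Lemma Uh_partB b x y : Uh_part b x -> Uh_part b y -> Uh_part b (x - y).
Proof. by move=> xb /Uh_partN; exact: Uh_partD. Qed.

Lemma Uh_partZ b c x : Uh_part b x -> Uh_part b (c *: x).
Proof. by move=> xb n; apply: Usl21_partZ. Qed.

Lemma Uh_partM a b x y :
  Uh_part a x -> Uh_part b y -> Uh_part (a (+) b) (x * y).
Proof.
move=> xa yb n; apply: (big_ind (Usl21_part (a (+) b))) => [|u w|i _].
- exact: Usl21_part0.
- exact: Usl21_partD.
- exact: Usl21_partM.
Qed.

Lemma Uh_part_scalar c : Uh_part false (fps_scalar c : A).
Proof. by move=> n; apply: Usl21_partZ; exact: Usl21_part1. Qed.

Lemma Uh_part_const b a : Usl21_part b a -> Uh_part b (fps_const a : A).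
Proof.
by move=> ab [|n] /=; rewrite ?mulr1n ?mulr0n //; exact: Usl21_part0.
Qed.

Lemma Uh_part1 : Uh_part false (1 : A).
Proof.
rewrite -(rmorph1 (@fps_const _ U)); exact/Uh_part_const/Usl21_part1.
Qed.

Lemma Uh_part_h : Uh_part false (hbar : A).
Proof. rewrite hbarE; exact: Uh_part_scalar. Qed.

Lemma Uh_partXn x n : Uh_part false x -> Uh_part false (x ^+ n).
Proof.
move=> x0; elim: n => [|n IHn]; first exact: Uh_part1.
rewrite exprS; exact: (Uh_partM x0 IHn).
Qed.

Lemma Uh_part_sqrt x : Uh_part false x -> Uh_part false (fps_sqrt x).
Proof.
move=> x0; apply: fps_sqrt_closed => //.
- exact: Usl21_part1.
- exact: Usl21_partB.
- by move=> u w u0 w0; exact: (Usl21_partM u0 w0).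
- exact: Usl21_partZ.
Qed.

Lemma Uh_part_disjoint x : Uh_part false x -> Uh_part true x -> x = 0.
Proof. by move=> x0 x1; apply: fpsP => n; exact: Usl21_part_disjoint. Qed.

Lemma Uh_part_decomp x : exists x0 x1,
  [/\ Uh_part false x0, Uh_part true x1 & x = x0 + x1].
Proof.
have [f fP] := choice (fun n => Usl21_part_decomp (fcoef x n)).
exists (Fps (fun n => (f n).1)), (Fps (fun n => (f n).2)).
by split=> [n|n|]; last (apply: fpsP => n); have [] := fP n.
Qed.

Lemma Uh_part_grading : is_superalgebra_grading (@Uh_part R).
Proof.
split=> [b x y|b c x xb|x|a b x y].
- exact: Uh_partD.
- exact: (Uh_partM (Uh_part_scalar c) xb).
- have [x0 [x1 [x0P x1P xE]]] := Uh_part_decomp x.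
  exists (x0, x1); split=> // -[y0 y1] /= [y0P y1P xE'].
  have d : x0 - y0 = y1 - x1.
    by apply/eqP; rewrite subr_eq addrAC eq_sym subr_eq addrC -xE' xE addrC.
  have d0 : x0 - y0 = 0.
    by apply: Uh_part_disjoint; [exact: Uh_partB|rewrite d; exact: Uh_partB].
  by rewrite (subr0_eq d0); rewrite d in d0; rewrite (subr0_eq d0).
- exact: Uh_partM.
Qed.

End UhGrading.

Section Uniqueness.
Variable R : realType.
Local Notation U := (Usl21 R).
Local Notation A := (Uh R).
Implicit Types x y : A.
Variables (gens : set A) (G : bool -> set A).
Hypothesis gens_gen : hadically_generates gens.
Hypothesis gens_part : forall x, gens x -> exists b, G b x /\ Uh_part b x.
Hypothesis gradG : is_superalgebra_grading G.

Lemma graded0 b : G b 0.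
Proof.
have [GD GZ Gx GM] := gradG; have [[y0 y1] [/= [y0P y1P _] _]] := Gx 0.
have z0 y : fps_scalar (fun=> 0) * y = 0 :> A.
  have -> : fps_scalar (fun=> 0) = 0 :> A.
    by apply: fpsP => n; rewrite /= scale0r.
  exact: mul0r.
by case: b; [rewrite -(z0 y1)|rewrite -(z0 y0)]; exact: GZ.
Qed.

Lemma graded_uniq x0 x1 y0 y1 :
  G false x0 -> G true x1 -> G false y0 -> G true y1 ->
  x0 + x1 = y0 + y1 -> x0 = y0 /\ x1 = y1.
Proof.
have [_ _ Gx _] := gradG; move=> x0P x1P y0P y1P xy.
have [p [_ puniq]] := Gx (x0 + x1).
have := puniq (x0, x1); have := puniq (y0, y1).
move=> -> /=; last by split.
move=> /(_ _) h.
have /h [-> ->] // : [/\ G false x0, G true x1 & x0 + x1 = x0 + x1].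
by split.
Qed.

(** If 1 = a + b with a even and b odd, comparing the parts of x = x a + x b for
    x homogeneous gives x b = 0. Hence b = a b + b b = 0. *)
Lemma graded1 : G false 1.
Proof.
have [GD GZ Gx GM] := gradG; have [[a b] [/= [aP bP ab] _]] := Gx 1.
have xb0 d x : G d x -> x * b = 0.
  move=> xP; have xE : x = x * a + x * b by rewrite -mulrDr -ab mulr1.
  have xaP := GM _ _ _ _ xP aP; have xbP := GM _ _ _ _ xP bP.
  case: d xP xaP xbP => /= xP xaP xbP.
  - have e : 0 + x = x * b + x * a by rewrite add0r addrC.
    by have [<-] := graded_uniq (graded0 false) xP xbP xaP e.
  - have e : x + 0 = x * a + x * b by rewrite addr0.
    by have [_ <-] := graded_uniq xP (graded0 true) xaP xbP e.
have b0 : b = 0.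
  by rewrite -[b]mul1r ab mulrDl (xb0 _ _ aP) (xb0 _ _ bP) addr0.
by rewrite ab b0 addr0.
Qed.

Lemma generated_homogeneous y : smallest (@is_Ch_subalgebra R) gens y ->
  exists y0 y1, [/\ G false y0 /\ Uh_part false y0,
    G true y1 /\ Uh_part true y1 & y = y0 + y1].
Proof.
have [GD GZ Gx GM] := gradG; have [PD PZ Px PM] := Uh_part_grading R.
pose H b := [set x | G b x /\ Uh_part b x].
have H0 b : H b 0 by split; [exact: graded0|move=> n; exact: Usl21_part0].
have HD b u w : H b u -> H b w -> H b (u + w).
  by move=> [? ?] [? ?]; split; [exact: GD|exact: PD].
have HM a b u w : H a u -> H b w -> H (a (+) b) (u * w).
  by move=> [? ?] [? ?]; split; [exact: GM|exact: PM].
have HZ b c u : H b u -> H b (fps_scalar c * u).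
  by move=> [? ?]; split; [exact: GZ|exact: PZ].
pose S := [set y | exists y0 y1, [/\ H false y0, H true y1 & y = y0 + y1]].
move=> /(_ S); apply; split; last first.
  move=> x /gens_part [[] xb].
  - by exists 0, x; split=> //; rewrite add0r.
  - by exists x, 0; split=> //; rewrite addr0.
split.
- exists 1, 0; split; rewrite ?addr0 //.
  by split; [exact: graded1|exact: Uh_part1].
- move=> _ _ [x0 [x1 [x0P x1P ->]]] [y0 [y1 [y0P y1P ->]]].
  exists (x0 + y0), (x1 + y1); rewrite addrACA.
  by split; [exact: HD|exact: HD|].
- move=> _ _ [x0 [x1 [x0P x1P ->]]] [y0 [y1 [y0P y1P ->]]].
  exists (x0 * y0 + x1 * y1), (x0 * y1 + x1 * y0).
  split; last exact: mulr_split.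
  + exact: HD (HM _ _ _ _ x0P y0P) (HM _ _ _ _ x1P y1P).
  + exact: HD (HM _ _ _ _ x0P y1P) (HM _ _ _ _ x1P y0P).
- move=> c _ [x0 [x1 [x0P x1P ->]]].
  exists (fps_scalar c * x0), (fps_scalar c * x1).
  by split; [exact: HZ|exact: HZ|exact: mulrDr].
Qed.

(** Let x have parity b. For each n, x is y_b + h^(n+1) z with y_b of parity b
    and in G b. The component of x in the other part of G is then h^(n+1) times
    that of z, so its coefficients of degree at most n vanish. *)
Lemma graded_sub b x : Uh_part b x -> G b x.
Proof.
have [GD GZ Gx GM] := gradG; move=> xb.
have [[g0 g1] [/= [g0P g1P xE] _]] := Gx x.
pose gd d := if d then g1 else g0.
suff gd0 : gd (~~ b) = 0.
  by case: b xb gd0 => /= xb gd0; rewrite xE gd0 ?add0r ?addr0.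
apply: fpsP => n; have [y Sy yx] := gens_gen x n.+1.
have [y0 [y1 [[y0G y0P] [y1G y1P] yE]]] := generated_homogeneous Sy.
pose yd d := if d then y1 else y0.
have yd0 i : (i < n.+1)%N -> fcoef (yd b) i = fcoef x i.
  move=> /yx; rewrite yE fcoefD => xi; have xbi := xb i.
  case: b xb xbi @yd {gd} => /= xb xbi.
  - suff y00 : fcoef y0 i = 0 by rewrite -xi y00 add0r.
    apply: Usl21_part_disjoint (y0P i) _.
    by rewrite -[fcoef y0 i](addrK (fcoef y1 i)) xi; exact: Usl21_partB.
  - suff y10 : fcoef y1 i = 0 by rewrite -xi y10 addr0.
    apply: Usl21_part_disjoint _ (y1P i).
    by rewrite -[fcoef y1 i](addKr (fcoef y0 i)) addrC xi; exact: Usl21_partB.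
have [z xz] : exists z, x - yd b = fps_scalar (fun i => (i == n.+1)%:R) * z.
  by apply: shiftP => i /yd0 xi; rewrite fcoefD fcoefN xi subrr.
have [[z0 z1] [/= [z0P z1P zE] _]] := Gx z.
have {}xz : x = yd b + fps_scalar (fun i => (i == n.+1)%:R) * z.
  by rewrite -xz addrCA subrr addr0.
set c := fps_scalar _ in xz.
have cz0 : G false (c * z0) by exact: GZ.
have cz1 : G true (c * z1) by exact: GZ.
have cn z' : fcoef (c * z') n = 0 by rewrite fcoef_shift ltnn.
have czE : c * z = c * z0 + c * z1 by rewrite zE; exact: mulrDr.
case: b xb @gd @yd yd0 xz => xb gd yd yd0 xz; rewrite /gd /= {gd}.
- have e : g0 + g1 = c * z0 + (y1 + c * z1).
    by rewrite -xE xz czE; exact: addrCA.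
  by have [-> _] := graded_uniq g0P g1P cz0 (GD _ _ _ y1G cz1) e; exact: cn.
- have e : g0 + g1 = (y0 + c * z0) + c * z1 by rewrite -xE xz czE; exact: addrA.
  by have [_ ->] := graded_uniq g0P g1P (GD _ _ _ y0G cz0) cz1 e; exact: cn.
Qed.

Lemma grading_unique b : G b = Uh_part b.
Proof.
apply/seteqP; split=> [x xG|x]; last exact: graded_sub.
have [x0 [x1 [x0P x1P xE]]] := Uh_part_decomp x.
have x0G := graded_sub x0P; have x1G := graded_sub x1P.
case: b xG => xG.
- have e : 0 + x = x0 + x1 by rewrite add0r.
  by have [_ ->] := graded_uniq (graded0 false) xG x0G x1G e.
- have e : x + 0 = x0 + x1 by rewrite addr0.
  by have [-> _] := graded_uniq xG (graded0 true) x0G x1G e.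
Qed.

End Uniqueness.

(** * The deformed generators *)

Section Generators.
Variable R : realType.
Local Notation U := (Usl21 R).
Local Notation A := (Uh R).

Definition deformed_gens : set A :=
  [set dH1 R; dT R; dTinv R; dF1 R; dH2 R; dE2 R; dF2 R; dH3 R; dE3 R;
    dF3 R].
Definition deformed_odd_gens : set A := [set dE2 R; dF2 R; dE3 R; dF3 R].

Lemma at_h0_dT : at_h0 (dT R) = 1.
Proof. exact: at_h0_exp. Qed.

Lemma at_h0_dTinv : at_h0 (dTinv R) = 1.
Proof. exact: at_h0_expN. Qed.

Lemma at_h0_dH1 : at_h0 (dH1 R) = h_1 R.
Proof. exact: at_h0_sqrt. Qed.

Lemma at_h0_dF1 : at_h0 (dF1 R) = f_1 R.
Proof. by apply: at_h0_perturbB; do 2!apply: at_h0_mul0; exact: at_h0_h2. Qed.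

Lemma at_h0_dH2 : at_h0 (dH2 R) = h_2 R.
Proof. by apply: at_h0_perturbB; do 2!apply: at_h0_mul0; exact: at_h0_h2. Qed.

Lemma at_h0_dE2 : at_h0 (dE2 R) = e_2 R.
Proof. by apply: at_h0_perturbB; do 3!apply: at_h0_mul0; exact: at_h0_h2. Qed.

Lemma at_h0_dH3 : at_h0 (dH3 R) = h_3 R.
Proof. by apply: at_h0_perturbD; do 2!apply: at_h0_mul0; exact: at_h0_h2. Qed.

Lemma at_h0_dF3 : at_h0 (dF3 R) = f_3 R.
Proof. by apply: at_h0_perturbD; do 3!apply: at_h0_mul0; exact: at_h0_h2. Qed.

Lemma at_h0_dF2dE3 : at_h0 (dF2 R * dE3 R + dE3 R * dF2 R) = e_1 R.
Proof.
apply: etrans (sl21_anticomm_f2_e3 (Usl21_system R)).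
exact: (etrans (rmorphD _ _ _)
  (congr2 _ (rmorphM _ _ _) (rmorphM _ _ _))).
Qed.

Lemma at_h0_generated a :
  exists2 y : A, smallest (@is_Ch_subalgebra R) deformed_gens y & at_h0 y = a.
Proof.
set S := smallest _ _.
have Sgen x : deformed_gens x -> S x by move=> gx J [_]; apply.
have S1 : S 1 by move=> J [[]].
have SD x y : S x -> S y -> S (x + y).
  move=> Sx Sy J JP; have [[_ D _ _] _] := JP.
  by apply: D; [exact: Sx|exact: Sy].
have SM x y : S x -> S y -> S (x * y).
  move=> Sx Sy J JP; have [[_ _ M _] _] := JP.
  by apply: M; [exact: Sx|exact: Sy].
have SZ c x : S x -> S (fps_scalar c * x).
  by move=> Sx J JP; have [[_ _ _ Z] _] := JP; apply: Z; exact: Sx.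
elim/Usl21_ind: a => [_ _ [x Sx <-] [y Sy <-]|_ _ [x Sx <-] [y Sy <-]|
  c _ [x Sx <-]||g].
- by exists (x + y); [exact: SD|].
- by exists (x * y); [exact: SM|exact: rmorphM].
- exists (fps_scalar (fun=> c) * x); first exact: SZ.
  by apply: etrans (rmorphM _ _ _) _; exact: mulr_algl.
- by exists 1.
- have I2 (i : 'I_2) : i = 0 \/ i = 1.
    by case: i => -[|[|//]] ?; [left|right]; apply: val_inj.
  case: g => [[i|i]|i]; case: (I2 i) => ->.
  + exists (dH1 R); last exact: at_h0_dH1.
    by apply: Sgen; do 9!left.
  + exists (dH2 R); last exact: at_h0_dH2.
    by apply: Sgen; do 5!left; right.
  (* e_1 occurs in T only with a factor h, so it is taken from {F_2, E_3}. *)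
  + exists (dF2 R * dE3 R + dE3 R * dF2 R); last exact: at_h0_dF2dE3.
    have SF : S (dF2 R) by apply: Sgen; do 3!left; right.
    have SE : S (dE3 R) by apply: Sgen; left; right.
    by apply: SD; apply: SM.
  + exists (dE2 R); last exact: at_h0_dE2.
    by apply: Sgen; do 4!left; right.
  + exists (dF1 R); last exact: at_h0_dF1.
    by apply: Sgen; do 6!left; right.
  + exists (dF2 R); last exact: at_h0_const.
    by apply: Sgen; do 3!left; right.
Qed.

(** If y_0 agrees with x modulo h, then x = y_0 + h x', and an approximation of
    x' modulo h^n yields one of x modulo h^(n+1). *)
Lemma deformed_generates : hadically_generates deformed_gens.
Proof.
move=> x n; elim: n x => [|n IHn] x.
  by exists 1 => // J [[]].
have [y0 Sy0 y0x] := at_h0_generated (at_h0 x).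
have [x' xE] : exists x', x - y0 = fps_scalar (fun i => (i == 1%N)%:R) * x'.
  apply: shiftP => -[|//] _.
  by rewrite fcoefD fcoefN -[fcoef y0 0]/(at_h0 y0) y0x subrr.
have [y' Sy' y'x] := IHn x'.
exists (y0 + fps_scalar (fun i => (i == 1%N)%:R) * y') => [|i lt_in].
  move=> J JP; have [[_ D _ Z] _] := JP.
  by apply: D; [exact: Sy0|apply: Z; exact: Sy'].
have -> : x = y0 + fps_scalar (fun i => (i == 1%N)%:R) * x'.
  by rewrite -xE addrCA subrr addr0.
exact: (fcoef_add_shift1 _ y'x).
Qed.

End Generators.

Section Bracket.
Variables (A : nzRingType) (O : set A).
Implicit Types x y : A.

(** With the parity set for O, the hypothesis says that x is even: its sign is
    then harmless even when x, being 0, is also odd. *)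
Lemma sbracket_comm_l x y : (O x -> x = 0) -> sbracket O x y = x * y - y * x.
Proof.
rewrite /sbracket.
case: asboolP => [Ox /(_ Ox) -> |_ _]; last by rewrite mul1r.
by rewrite mul0r mulr0 mulr0.
Qed.

Lemma sbracket_comm_r x y : (O y -> y = 0) -> sbracket O x y = x * y - y * x.
Proof.
rewrite /sbracket andbC.
case: asboolP => [Oy /(_ Oy) -> |_ _]; last by rewrite mul1r.
by rewrite mul0r mulr0 mulr0.
Qed.

Lemma sbracket_anticomm x y : O x -> O y -> sbracket O x y = x * y + y * x.
Proof.
by move=> Ox Oy; rewrite /sbracket !asboolT //= mulN1r opprK.
Qed.
End Bracket.

Section Parity.
Variable R : realType.
Local Notation U := (Usl21 R).
Local Notation A := (Uh R).
Local Notation "x %:h" := (fps_const x : A) (at level 2).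

Lemma Uh_part_nat n : Uh_part false (n%:R : A).
Proof.
elim: n => [|n IHn]; first by move=> k; exact: Usl21_part0.
by rewrite mulrS; apply: Uh_partD; first exact: Uh_part1.
Qed.

Lemma even_h1 : Uh_part false (h_1 R)%:h.
Proof. exact: Uh_part_const (Usl21_part_gen R (inl (inl 0))). Qed.

Lemma even_h2 : Uh_part false (h_2 R)%:h.
Proof. exact: Uh_part_const (Usl21_part_gen R (inl (inl 1))). Qed.

Lemma even_e1 : Uh_part false (e_1 R)%:h.
Proof. exact: Uh_part_const (Usl21_part_gen R (inl (inr 0))). Qed.

Lemma even_f1 : Uh_part false (f_1 R)%:h.
Proof. exact: Uh_part_const (Usl21_part_gen R (inr 0)). Qed.

Lemma odd_e2 : Uh_part true (e_2 R)%:h.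
Proof. exact: Uh_part_const (Usl21_part_gen R (inl (inr 1))). Qed.

Lemma odd_f2 : Uh_part true (f_2 R)%:h.
Proof. exact: Uh_part_const (Usl21_part_gen R (inr 1)). Qed.

Lemma const_e3 :
  (e_3 R)%:h = (e_1 R)%:h * (e_2 R)%:h - (e_2 R)%:h * (e_1 R)%:h.
Proof. exact: rmorph_commutator. Qed.

Lemma const_f3 :
  (f_3 R)%:h = (f_2 R)%:h * (f_1 R)%:h - (f_1 R)%:h * (f_2 R)%:h.
Proof. exact: rmorph_commutator. Qed.

Lemma const_h3 : (h_3 R)%:h = (h_1 R)%:h + (h_2 R)%:h.
Proof. exact: rmorphD. Qed.

Lemma odd_e3 : Uh_part true (e_3 R)%:h.
Proof.
rewrite const_e3; apply: Uh_partB.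
- exact: Uh_partM even_e1 odd_e2.
- exact: Uh_partM odd_e2 even_e1.
Qed.

Lemma odd_f3 : Uh_part true (f_3 R)%:h.
Proof.
rewrite const_f3; apply: Uh_partB.
- exact: Uh_partM odd_f2 even_f1.
- exact: Uh_partM even_f1 odd_f2.
Qed.

Let even_h := Uh_part_h R.
Let EM := @Uh_partM R false false.
Let even_hh : Uh_part false (hbar ^+ 2 : A) := Uh_partXn 2 even_h.

Lemma even_sqrt : Uh_part false (sqrt_1_h2e2 R).
Proof.
apply: Uh_part_sqrt; apply: Uh_partD; first exact: Uh_part1.
exact: EM even_hh (Uh_partXn 2 even_e1).
Qed.

Lemma even_dT : Uh_part false (dT R).
Proof. exact: Uh_partD (EM even_h even_e1) even_sqrt. Qed.

Lemma even_dTinv : Uh_part false (dTinv R).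
Proof. exact: Uh_partD (Uh_partN (EM even_h even_e1)) even_sqrt. Qed.

Lemma even_dH1 : Uh_part false (dH1 R).
Proof. exact: EM even_sqrt even_h1. Qed.

Lemma even_dF1 : Uh_part false (dF1 R).
Proof.
apply: Uh_partB even_f1 (Uh_partZ _ (EM (EM even_hh even_e1) _)).
exact: Uh_partB (Uh_partXn 2 even_h1) (Uh_part1 R).
Qed.

Lemma even_dH2 : Uh_part false (dH2 R).
Proof.
exact: Uh_partB even_h2
  (Uh_partZ _ (EM (EM even_hh (Uh_partXn 2 even_e1)) even_h1)).
Qed.

Lemma even_dH3 : Uh_part false (dH3 R).
Proof.
apply: Uh_partD (Uh_partZ _ (EM (EM even_hh (Uh_partXn 2 even_e1)) even_h1)).
rewrite const_h3; exact: Uh_partD even_h1 even_h2.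
Qed.

Let even_2h1_1 : Uh_part false (2 * (h_1 R)%:h + 1 : A) :=
  Uh_partD (EM (Uh_part_nat 2) even_h1) (Uh_part1 R).

Lemma odd_dE2 : Uh_part true (dE2 R).
Proof.
exact: Uh_partB odd_e2 (Uh_partZ _
  (Uh_partM (Uh_partM (EM even_hh even_e1) odd_e3) even_2h1_1)).
Qed.

Lemma odd_dF3 : Uh_part true (dF3 R).
Proof.
exact: Uh_partD odd_f3 (Uh_partZ _
  (Uh_partM (Uh_partM (EM even_hh even_e1) odd_f2) even_2h1_1)).
Qed.

Lemma odd_gens_odd (X : A) : deformed_odd_gens X -> Uh_part true X.
Proof.
move=> [[[->|->]|->]|->].
- exact: odd_dE2.
- exact: odd_f2.
- exact: odd_e3.
- exact: odd_dF3.
Qed.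

Lemma gens_odd_or_even (X : A) :
  deformed_gens X -> deformed_odd_gens X \/ Uh_part false X.
Proof.
move=> [[[[[[[[[->|->]|->]|->]|->]|->]|->]|->]|->]|->].
- by right; exact: even_dH1.
- by right; exact: even_dT.
- by right; exact: even_dTinv.
- by right; exact: even_dF1.
- by right; exact: even_dH2.
- by left; do 3!left.
- by left; do 2!left; right.
- by right; exact: even_dH3.
- by left; left; right.
- by left; right.
Qed.

Lemma gens_neq0 (X : A) : deformed_gens X -> X <> 0.
Proof.
have [[h1 h2 h3 f1] [e2 f2 e3 f3]] := Usl21_gens_neq0 R.
have nz Y (a : U) : at_h0 Y = a -> a != 0 -> Y <> 0.
  by move=> <- /eqP a0 Y0; apply: a0; rewrite Y0.
move=> [[[[[[[[[->|->]|->]|->]|->]|->]|->]|->]|->]|->].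
- exact: nz (at_h0_dH1 R) h1.
- exact: nz (at_h0_dT R) (oner_neq0 _).
- exact: nz (at_h0_dTinv R) (oner_neq0 _).
- exact: nz (at_h0_dF1 R) f1.
- exact: nz (at_h0_dH2 R) h2.
- exact: nz (at_h0_dE2 R) e2.
- exact: nz (at_h0_const _) f2.
- exact: nz (at_h0_dH3 R) h3.
- exact: nz (at_h0_const _) e3.
- exact: nz (at_h0_dF3 R) f3.
Qed.

Lemma gens_parity (X : A) : deformed_gens X ->
  (Uh_part true X <-> deformed_odd_gens X) /\
  (Uh_part false X <-> ~ deformed_odd_gens X).
Proof.
move=> gX; have X0 := gens_neq0 gX.
have excl : Uh_part false X -> Uh_part true X -> False.
  by move=> x0 x1; apply: X0; exact: Uh_part_disjoint.
split; split.
- by move=> X1; have [//|X0'] := gens_odd_or_even gX; case: (excl X0' X1).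
- exact: odd_gens_odd.
- by move=> Xe /odd_gens_odd; exact: excl.
- by move=> nodd; have [/nodd|] := gens_odd_or_even gX.
Qed.

Local Notation e1h := (e_1 R)%:h.

(** The deformed generators in terms of the letters: e_3, f_3 and h_3 are
    expanded. *)
Lemma dE2_expand : dE2 R = (e_2 R)%:h - 4^-1 *: (hbar ^+ 2 * e1h *
  (e1h * (e_2 R)%:h - (e_2 R)%:h * e1h) * (2 * (h_1 R)%:h + 1)).
Proof.
exact: (congr1 (fun z => (e_2 R)%:h - 4^-1 *: (hbar ^+ 2 * e1h * z *
  (2 * (h_1 R)%:h + 1))) const_e3).
Qed.

Lemma dH3_expand : dH3 R = (h_1 R)%:h + (h_2 R)%:h +
  2^-1 *: (hbar ^+ 2 * e1h ^+ 2 * (h_1 R)%:h).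
Proof. exact: (congr1 (+%R^~ _) const_h3). Qed.

Lemma dF3_expand : dF3 R = (f_2 R)%:h * (f_1 R)%:h - (f_1 R)%:h * (f_2 R)%:h +
  4^-1 *: (hbar ^+ 2 * e1h * (f_2 R)%:h * (2 * (h_1 R)%:h + 1)).
Proof. exact: (congr1 (+%R^~ _) const_f3). Qed.

End Parity.

(** * The relations between the deformed generators *)

Section Dyadics.
Variable R : realType.
Local Notation C := (complexes R).

(** The scalars of the relations in the form read by [nc]. The negative ones are
    kept apart since they contain their opposites, and are rewritten first. *)
Lemma neg_dyadic_constants :
  (- 2^-1 = dval C (Z.opp 1, 1%N)) * (- 4^-1 = dval C (Z.opp 1, 2%N)) *
  (- 8^-1 = dval C (Z.opp 1, 3%N)).
Proof.
by rewrite /dval /zval /= !exprVn -!natrX !(mulN1r, mulrNz, mulr1z).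
Qed.

Lemma dyadic_constants :
  (3 / 8 = dval C (Zpos 3, 3%N)) * (15 / 64 = dval C (Zpos 15, 6%N)) *
  (7 / 128 = dval C (Zpos 7, 7%N)) * (2^-1 = dval C (Zpos 1, 1%N)) *
  (4^-1 = dval C (Zpos 1, 2%N)) * (8^-1 = dval C (Zpos 1, 3%N)) *
  (16^-1 = dval C (Zpos 1, 4%N)).
Proof.
by rewrite /dval /zval /= !exprVn -!natrX !(mul1r, mulr1z).
Qed.

End Dyadics.

Theorem proposition1 (R : realType) :
  let h : Uh R := hbar in
  let T := dT R in let T' := dTinv R in
  let H1 := dH1 R in let F1 := dF1 R in
  let H2 := dH2 R in let E2 := dE2 R in let F2 := dF2 R in
  let H3 := dH3 R in let E3 := dE3 R in let F3 := dF3 R in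
  let gens : set (Uh R) := [set H1; T; T'; F1; H2; E2; F2; H3; E3; F3] in
  let odd_gens : set (Uh R) := [set E2; F2; E3; F3] in
  let br : Uh R -> Uh R -> Uh R := sbracket (Uh_part true) in
  (* generation and grading *)
  hadically_generates gens /\
  is_superalgebra_grading (@Uh_part R) /\
  (forall X, gens X ->
     (Uh_part true X <-> odd_gens X) /\ (Uh_part false X <-> ~ odd_gens X)) /\
  (forall G : bool -> set (Uh R), is_superalgebra_grading G ->
     (forall X, gens X ->
        (odd_gens X -> G true X) /\ (~ odd_gens X -> G false X)) ->
     forall b, G b = Uh_part b) /\
  (* relations *)
  (T * T' = 1 /\ T' * T = 1) /\
  (br H1 T = T ^+ 2 - 1 /\ br H1 T' = T' ^+ 2 - 1) /\
  (br T F1 = 2^-1 *: (h * (H1 * T + T * H1)) /\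
   br T' F1 = - 2^-1 *: (h * (H1 * T' + T' * H1))) /\
  br H1 F1 = - 2^-1 *: (T * F1 + F1 * T + T' * F1 + F1 * T') /\
  br H1 H2 = - 4^-1 *: ((T - T') ^+ 2 * H1) /\
  br H1 H3 = 4^-1 *: ((T - T') ^+ 2 * H1) /\
  br H2 H3 = 0 /\
  br H1 E2 = - 2^-1 *: ((T + T') * E2)
             - 2^-1 *: (h * (T - T') * E3 * H1)
             - 4^-1 *: (h * (T ^+ 2 - T' ^+ 2) * E3) /\
  br H1 F3 = - 2^-1 *: ((T + T') * F3)
             + 2^-1 *: (h * (T - T') * F2 * H1)
             + 4^-1 *: (h * (T ^+ 2 - T' ^+ 2) * F2) /\
  br H1 F2 = 2^-1 *: ((T + T') * F2) /\
  br H1 E3 = 2^-1 *: ((T + T') * E3) /\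
  (br H2 T = - 4^-1 *: (T ^+ 3 - T') /\
   br H2 T' = - 4^-1 *: (T' ^+ 3 - T)) /\
  (br H3 T = 4^-1 *: (T ^+ 3 - T') /\
   br H3 T' = 4^-1 *: (T' ^+ 3 - T)) /\
  br H2 F1 = 4^-1 *: ((T + T') ^+ 2 * F1)
             - 4^-1 *: (h * (T - T') * H1 ^+ 2)
             - 4^-1 *: (h * (T ^+ 2 - T' ^+ 2) * H1)
             - 16^-1 *: (h * (T ^+ 2 - T' ^+ 2) * (T + T')) /\
  br H3 F1 = - 4^-1 *: ((T + T') ^+ 2 * F1)
             + 4^-1 *: (h * (T - T') * H1 ^+ 2)
             + 4^-1 *: (h * (T ^+ 2 - T' ^+ 2) * H1)
             + 16^-1 *: (h * (T ^+ 2 - T' ^+ 2) * (T + T')) /\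
  br H2 E2 = 16^-1 *: (h * (T + T') * (T ^+ 2 - T' ^+ 2) * E3)
             + 8^-1 *: ((T - T') ^+ 2 * E2) /\
  br H3 F3 = 16^-1 *: (h * (T + T') * (T ^+ 2 - T' ^+ 2) * F2)
             - 8^-1 *: ((T - T') ^+ 2 * F3) /\
  br H2 F3 = 8^-1 *: ((T ^+ 2 + 6 + T' ^+ 2) * F3)
             - 16^-1 *: (h * (T ^+ 2 - T' ^+ 2) * (T + T') * F2) /\
  br H3 E2 = - 8^-1 *: ((T ^+ 2 + 6 + T' ^+ 2) * E2)
             - 16^-1 *: (h * (T ^+ 2 - T' ^+ 2) * (T + T') * E3) /\
  br H2 F2 = - 8^-1 *: ((T - T') ^+ 2 * F2) /\
  br H3 E3 = 8^-1 *: ((T - T') ^+ 2 * E3) /\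
  br H3 F2 = 8^-1 *: ((T ^+ 2 + 6 + T' ^+ 2) * F2) /\
  br H2 E3 = - 8^-1 *: ((T ^+ 2 + 6 + T' ^+ 2) * E3) /\
  br E2 F2 = H2 - 16^-1 *: (T - T') ^+ 2
             - 4^-1 *: (h * (T - T') * E3 * F2) /\
  br E3 F3 = H3 + 16^-1 *: (T - T') ^+ 2
             + 4^-1 *: (h * (T - T') * F2 * E3) /\
  (br T F2 = 0 /\ br T' F2 = 0 /\ br T E3 = 0 /\ br T' E3 = 0) /\
  (F2 ^+ 2 = 0 /\ E3 ^+ 2 = 0) /\
  br F2 F1 = F3 /\
  br F1 E3 = E2 /\
  E2 ^+ 2 = 4^-1 *: (h * (T - T') * E3 * E2) /\
  F3 ^+ 2 = - 4^-1 *: (h * (T - T') * F2 * F3) /\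
  (br E2 E3 = 0 /\ br F2 F3 = 0) /\
  (br T E2 = 2^-1 *: (h * (T ^+ 2 + 1) * E3) /\
   br T' E2 = - 2^-1 *: (h * (T' ^+ 2 + 1) * E3)) /\
  (br T F3 = - 2^-1 *: (h * (T ^+ 2 + 1) * F2) /\
   br T' F3 = 2^-1 *: (h * (T' ^+ 2 + 1) * F2)) /\
  (* [F2, E3] is the unique element whose product with 2h is T - T' *)
  unique (fun X : Uh R => 2 * h * X = T - T') (br F2 E3) /\
  br E2 F1 = 4^-1 *: (h * (T - T') * E2)
             + 2^-1 *: (h * (T - T') * E3 * F1)
             - 4^-1 *: (h ^+ 2 * E3 * H1 ^+ 2)
             - (3 / 8) *: (h ^+ 2 * (T + T') * E3 * H1)
             - 2^-1 *: (h ^+ 2 * E3)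
             - (15 / 64) *: (h ^+ 2 * (T - T') ^+ 2 * E3) /\
  br F3 F1 = 4^-1 *: (h * (T - T') * F3)
             - 2^-1 *: (h * (T - T') * F2 * F1)
             + 4^-1 *: (h ^+ 2 * F2 * H1 ^+ 2)
             + (3 / 8) *: (h ^+ 2 * (T + T') * F2 * H1)
             + 2^-1 *: (h ^+ 2 * F2)
             + (15 / 64) *: (h ^+ 2 * (T - T') ^+ 2 * F2) /\
  br F3 E2 = F1 - 4^-1 *: (h * (T - T') * F2 * E2)
             + 4^-1 *: (h * (T - T') * E3 * F3)
             - 8^-1 *: (h * (T - T') * H1 ^+ 2)
             - 8^-1 *: (h * (T ^+ 2 - T' ^+ 2) * H1)
             - 16^-1 *: (h * H1 * (T ^+ 2 - T' ^+ 2))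
             + (7 / 128) *: (h * (T - T') ^+ 3) /\
  (* the limit h -> 0 *)
  [/\ at_h0 E2 = e_2 R, at_h0 F2 = f_2 R & at_h0 H2 = h_2 R] /\
  [/\ at_h0 E3 = e_3 R, at_h0 F3 = f_3 R & at_h0 H3 = h_3 R].
Proof.
move=> h T T' H1 F1 H2 E2 F2 H3 E3 F3 gens odd_gens br.
split; first exact: deformed_generates.
split; first exact: Uh_part_grading.
split; first exact: gens_parity.
split.
  move=> G gradG Ggens b.
  apply: (@grading_unique R _ G (@deformed_generates R) _ gradG b) => X gX.
  have [Xodd Xeven] := gens_parity gX; have [G1 G0] := Ggens X gX.
  have [oX|nX] := pselect (odd_gens X).
  - by exists true; split; [exact: G1|apply/Xodd].
  - by exists false; split; [exact: G0|apply/Xeven].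
have [u P] : exists u, sound_rules
    (nth 0 (letters (hbar : Uh R) (sqrt_1_h2e2 R) u
    (fps_const (h_1 R)) (fps_const (h_2 R)) (fps_const (e_1 R))
    (fps_const (e_2 R)) (fps_const (f_1 R)) (fps_const (f_2 R))))
    deformed_rules.
  exact: series_deformed_sound (Usl21_system R).
have br_l x y : Uh_part false x -> br x y = x * y - y * x.
  by move=> x0; apply: sbracket_comm_l; exact: Uh_part_disjoint.
have br_r x y : Uh_part false y -> br x y = x * y - y * x.
  by move=> x0; apply: sbracket_comm_r; exact: Uh_part_disjoint.
have br_o x y : Uh_part true x -> Uh_part true y -> br x y = x * y + y * x.
  exact: sbracket_anticomm.
(* One equation for each bracket that occurs: an even argument on either side
   gives a commutator, two odd ones an anticommutator. *)
have brE := (br_l T ^~ (even_dT R), br_l T' ^~ (even_dTinv R),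
  br_l H1 ^~ (even_dH1 R), br_l H2 ^~ (even_dH2 R), br_l H3 ^~ (even_dH3 R),
  br_l F1 ^~ (even_dF1 R), (fun x => br_r x F1 (even_dF1 R)),
  br_o E2 F2 (odd_dE2 R) (odd_f2 R), br_o E3 F3 (odd_e3 R) (odd_dF3 R),
  br_o E2 E3 (odd_dE2 R) (odd_e3 R), br_o F2 F3 (odd_f2 R) (odd_dF3 R),
  br_o F2 E3 (odd_f2 R) (odd_e3 R), br_o F3 E2 (odd_dF3 R) (odd_dE2 R)).
have f2e3_unique : unique (fun X : Uh R => 2 * h * X = T - T') (br F2 E3).
  have prod : 2 * h * br F2 E3 = T - T'.
    rewrite brE /F2 /E3 /T /T' /h /dF2 /dE3 const_e3 /dT /dTinv; nc P.
  split=> // Y hY; apply: two_hbar_inj (etrans prod (esym hY)).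
  by rewrite pnatr_eq0.
have defs := (erefl _ : h = hbar, erefl _ : T = dT R, erefl _ : T' = dTinv R,
  erefl _ : H1 = dH1 R, erefl _ : F1 = dF1 R, erefl _ : H2 = dH2 R,
  dE2_expand R : E2 = _, erefl _ : F2 = dF2 R, dH3_expand R : H3 = _,
  const_e3 R : E3 = _, dF3_expand R : F3 = _).
repeat match goal with |- _ /\ _ => split end.
all: lazymatch goal with
  | |- unique _ _ => exact: f2e3_unique
  | |- and3 _ _ _ => first
      [ by split; [exact: at_h0_dE2|exact: at_h0_const|exact: at_h0_dH2]
      | by split; [exact: at_h0_const|exact: at_h0_dF3|exact: at_h0_dH3]]
  | |- _ => idtac
  end.
(* The names of the deformed generators are made opaque so that rewriting does
   not unfold their definitions when comparing them. *)
all: clear f2e3_unique br_l br_r br_o gens odd_gens.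
all: clearbody br F3 E3 H3 F2 E2 H2 F1 H1 T' T h.
all: rewrite ?brE.
all: rewrite !defs /dT /dTinv /dH1 /dF1 /dH2 /dF2.
all: rewrite ?neg_dyadic_constants ?dyadic_constants.
all: nc P.
Qed.
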